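(* Let $n,d,r$ be integers with $r\ge 0$ and $n\ge d\ge 2r+2$. Then there exist a combinatorial $n$-cube $C^n\subseteq\mathbb{R}^n$ and a linear projection map $\pi:\mathbb{R}^n\to\mathbb{R}^d$ such that $C_d^n:=\pi(C^n)$ is a cubical $d$-polytope whose $r$-skeleton is isomorphic to that of $C^n$ via $\pi$ (that is, $\pi$ maps each face of $C^n$ of dimension at most $r$ bijectively onto a face of $C_d^n$, and this induces an isomorphism between the $r$-skeleton of $C^n$ and the $r$-skeleton of $C_d^n$).
   Context: All polytopes are convex polytopes. Two polytopes or polytopal complexes are combinatorially equivalent if their posets of faces are isomorphic. A combinatorial $n$-cube is a polytope combinatorially equivalent to the standard cube $[0,1]^n$. A cubical polytope is a polytope all of whose proper faces are combinatorial cubes (of their respective dimensions). The $r$-skeleton of a polytope is the polytopal complex formed by all its faces of dimension at most $r$. *)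

(* Defs.v *)
From mathcomp Require Export all_boot all_order all_algebra.
From mathcomp Require Export all_classical all_reals.

Set Implicit Arguments.
Unset Strict Implicit.
Unset Printing Implicit Defensive.

Import Order.TTheory GRing.Theory Num.Theory.
Local Open Scope classical_set_scope.
Local Open Scope ring_scope.

Section Polytopes.
Variable R : realType.

Definition aff_hull n (S : set 'rV[R]_n) : set 'rV[R]_n :=
  [set x | exists (m : nat) (p : 'I_m -> 'rV[R]_n) (w : 'I_m -> R),
     [/\ forall i, S (p i), \sum_i w i = 1 & x = \sum_i w i *: p i]].

Definition conv_hull n (S : set 'rV[R]_n) : set 'rV[R]_n :=
  [set x | exists (m : nat) (p : 'I_m -> 'rV[R]_n) (w : 'I_m -> R),
     [/\ forall i, S (p i), forall i, 0 <= w i, \sum_i w i = 1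
       & x = \sum_i w i *: p i]].

Definition polytope n (P : set 'rV[R]_n) : Prop :=
  exists2 V : set 'rV[R]_n, finite_set V & P = conv_hull V.

(* The affine hull is a translate of a k-dimensional linear subspace. The empty
   set (of dimension -1 by convention) satisfies [has_dim] for no k : nat. *)
Definition has_dim n (S : set 'rV[R]_n) (k : nat) : Prop :=
  exists (x : 'rV[R]_n) (U : {vspace 'rV[R]_n}),
    \dim U = k /\ aff_hull S = [set x + u | u in [set u | u \in U]].

(* The case c = 0 makes set0 and P itself faces of P. *)
Definition face n (P F : set 'rV[R]_n) : Prop :=
  exists (c : 'cV[R]_n) (b : R),
    (forall x, P x -> (x *m c) ord0 ord0 <= b) /\
    F = P `&` [set x | (x *m c) ord0 ord0 = b].

(* set0 belongs to every skeleton. *)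
Definition skeleton n (P : set 'rV[R]_n) (r : nat) : set (set 'rV[R]_n) :=
  [set F | face P F /\ (F = set0 \/ exists2 k : nat, (k <= r)%N & has_dim F k)].

Definition poset_iso (T U : Type) (A : set (set T)) (B : set (set U))
    (f : set T -> set U) : Prop :=
  set_bij A B f /\
  forall F G, A F -> A G -> (f F `<=` f G <-> F `<=` G).

Definition comb_equiv n m (P : set 'rV[R]_n) (Q : set 'rV[R]_m) : Prop :=
  exists f : set 'rV[R]_n -> set 'rV[R]_m, poset_iso (face P) (face Q) f.

Definition std_cube (k : nat) : set 'rV[R]_k :=
  [set x | forall i, 0 <= x ord0 i <= 1].

Definition comb_cube n (k : nat) (P : set 'rV[R]_n) : Prop :=
  polytope P /\ comb_equiv P (@std_cube k).

(* The empty face is excluded by [has_dim]. *)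
Definition cubical n (P : set 'rV[R]_n) : Prop :=
  polytope P /\
  forall F k, face P F -> F <> P -> has_dim F k -> comb_cube k F.

Definition skeleton_iso_via n d (pi : 'rV[R]_n -> 'rV[R]_d)
    (P : set 'rV[R]_n) (Q : set 'rV[R]_d) (r : nat) : Prop :=
  (forall F, skeleton P r F -> set_bij F (pi @` F) pi /\ face Q (pi @` F)) /\
  poset_iso (skeleton P r) (skeleton Q r) (fun F => pi @` F).

End Polytopes.

(* Main.v *)
(** Following Joswig and Ziegler, C is a deformed cube with facet normals
    b_i + eps e_i and b_i - eps e_i, where b_i only has entries before the i-th
    and among the first n - d coordinates, and eps > 0 is small; pi keeps
    the last d coordinates.  A face of C is preserved by pi as soon as the
    normals of the facets through it, truncated to the first n - d coordinates,
    span and have a positive dependency with full support.  For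
    eps = 0 the truncated normals, except for the first one which vanishes,
    are a Gale dual of the n - 1 points 1, ..., n - 1 on the moment curve of
    R^(d-2) (Lagrange weights times Newton polynomials): their dependencies are
    the values of polynomials of degree at most d - 2, and the square of the
    polynomial vanishing at r prescribed nodes is a positive dependency of the
    others because 2r <= d - 2.  Both this positivity and general position
    survive for small eps > 0, and general position makes every proper face of
    pi(C) an affine image of a face of C, hence a cube. *)

Require Import Defs.
From mathcomp Require Import ring lra zify.

Set Implicit Arguments.
Unset Strict Implicit.
Unset Printing Implicit Defensive.

Import Order.TTheory GRing.Theory Num.Theory.
Local Open Scope classical_set_scope.
Local Open Scope ring_scope.

(** * Linear functionals, convexity and polytopes *)

Definition dot (R : realType) n (x : 'rV[R]_n) (c : 'cV[R]_n) : R :=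
  (x *m c) ord0 ord0.

Section Convexity.
Variable R : realType.
Implicit Types (n m : nat).

Lemma dotDl n (x y : 'rV[R]_n) c : dot (x + y) c = dot x c + dot y c.
Proof. by rewrite /dot mulmxDl mxE. Qed.

Lemma dotBl n (x y : 'rV[R]_n) c : dot (x - y) c = dot x c - dot y c.
Proof. by rewrite /dot mulmxBl !mxE. Qed.

Lemma dotZl n a (x : 'rV[R]_n) c : dot (a *: x) c = a * dot x c.
Proof. by rewrite /dot -scalemxAl mxE. Qed.

Lemma dotDr n (x : 'rV[R]_n) c c' : dot x (c + c') = dot x c + dot x c'.
Proof. by rewrite /dot mulmxDr mxE. Qed.

Lemma dot0r n (x : 'rV[R]_n) : dot x 0 = 0.
Proof. by rewrite /dot mulmx0 mxE. Qed.

Lemma dot_suml n (I : finType) (F : I -> 'rV[R]_n) c :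
  dot (\sum_i F i) c = \sum_i dot (F i) c.
Proof. by rewrite /dot mulmx_suml summxE. Qed.

Lemma dot_mulmx n m (x : 'rV[R]_n) (A : 'M_(n, m)) c :
  dot (x *m A) c = dot x (A *m c).
Proof. by rewrite /dot mulmxA. Qed.

Lemma dot_eq0 n (c : 'cV[R]_n) : (forall x, dot x c = 0) -> c = 0.
Proof.
move=> c0; apply/matrixP => i j; rewrite (ord1 j) mxE.
by have := c0 (delta_mx 0 i); rewrite /dot -rowE mxE.
Qed.

Definition convex n (P : set 'rV[R]_n) :=
  forall x y a, P x -> P y -> 0 <= a <= 1 -> P ((1 - a) *: x + a *: y).

Lemma conv_hull_sub n (S : set 'rV[R]_n) : S `<=` conv_hull S.
Proof.
move=> x Sx; exists 1%N, (fun=> x), (fun=> 1); split=> //.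
  by rewrite big_ord1.
by rewrite big_ord1 scale1r.
Qed.

Lemma conv_hull_convex n (S : set 'rV[R]_n) : convex (conv_hull S).
Proof.
move=> _ _ a [m [p [w [Sp w0 w1 ->]]]] [m' [p' [w' [Sp' w0' w1' ->]]]].
move=> /andP[a0 a1].
exists (m + m')%N,
  (fun i => match fintype.split i with inl j => p j | inr j => p' j end),
  (fun i => match fintype.split i with
            | inl j => (1 - a) * w j | inr j => a * w' j end).
split.
- by move=> i; case: (fintype.split i).
- by move=> i; case: (fintype.split i) => j; rewrite mulr_ge0 ?subr_ge0.
- rewrite big_split_ord /=.
  under eq_bigr => i _ do rewrite -[lshift _ i]/(unsplit (inl i)) unsplitK.
  under [X in _ + X]eq_bigr => i _ do
    rewrite -[rshift _ i]/(unsplit (inr i)) unsplitK.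
  by rewrite -!mulr_sumr w1 w1' !mulr1 subrK.
- rewrite big_split_ord /= !scaler_sumr; congr (_ + _); apply: eq_bigr => i _.
    by rewrite -[lshift _ i]/(unsplit (inl i)) unsplitK scalerA.
  by rewrite -[rshift _ i]/(unsplit (inr i)) unsplitK scalerA.
Qed.

Lemma image_polytope n m (P : set 'rV[R]_n) (A : 'M[R]_(n, m)) :
  polytope P -> polytope [set x *m A | x in P].
Proof.
case=> V finV ->; exists [set x *m A | x in V]; first exact: finite_image.
apply/seteqP; split=> [_ [_ [k [p [w [Vp w0 w1 ->]]]] <-] | x].
  exists k, (fun i => p i *m A), w; split=> //; first by move=> i; exists (p i).
  by rewrite mulmx_suml; apply: eq_bigr => i _; rewrite scalemxAl.
case=> k [q [w [Vq w0 w1 ->]]].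
have /choice[p Vp] : forall i, exists p, V p /\ p *m A = q i.
  by move=> i; have [p] := Vq i; exists p.
exists (\sum_i w i *: p i).
  by exists k, p, w; split=> // i; have [] := Vp i.
by rewrite mulmx_suml; apply: eq_bigr => i _; rewrite -scalemxAl (Vp i).2.
Qed.

(** In a convex combination that attains the maximum b, the weighted slacks of the generators are
    nonnegative and sum to 0, so only generators on the face carry weight. *)
Lemma face_polytope n (P F : set 'rV[R]_n) : polytope P -> face P F -> polytope F.
Proof.
case=> V finV ->{P} [c [b [Pb ->{F}]]].
exists (V `&` [set x | dot x c = b]); first exact: finite_setIl.
apply/seteqP; split=> [_ [[k [p [w [Vp w0 w1 ->]]]] xb] | x].
  have pb i : dot (p i) c <= b by apply: Pb; apply: conv_hull_sub.
  have slack0 : \sum_i w i * (b - dot (p i) c) = 0.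
    under eq_bigr do rewrite mulrBr.
    rewrite sumrB -mulr_suml w1 mul1r.
    have : dot (\sum_i w i *: p i) c = b by [].
    rewrite dot_suml => <-; rewrite -sumrB big1// => i _.
    by rewrite dotZl subrr.
  have tight i : w i != 0 -> dot (p i) c = b.
    move=> wi; apply/eqP; rewrite eq_sym -subr_eq0; apply/eqP.
    have /psumr_eq0P/(_ _ i isT)/eqP : forall i, true -> 0 <= w i * (b - dot (p i) c).
      by move=> j _; rewrite mulr_ge0 ?subr_ge0.
    by rewrite mulf_eq0 (negPf wi) => /(_ slack0)/eqP.
  have [i0 wi0] : exists i, w i != 0.
    apply: contrapT => /forallNP w_0; have := oner_neq0 R.
    by rewrite -w1 big1 ?eqxx// => i _; apply/eqP/negPn/negP/w_0.
  (* Generators of weight 0 may lie off the face; they are replaced by the tight generator [p i0],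
     which leaves the sum unchanged. *)
  exists k, (fun i => if w i == 0 then p i0 else p i), w; split=> //.
    move=> i; case: eqVneq => [_|wi]; first by split; [|exact: tight].
    by split; [|exact: tight].
  by apply: eq_bigr => i _; case: eqVneq => // ->; rewrite !scale0r.
case=> k [p [w [Vp w0 w1 ->]]]; split.
  by exists k, p, w; split=> // i; have [] := Vp i.
change (dot (\sum_i w i *: p i) c = b); rewrite dot_suml.
under eq_bigr => i _ do rewrite dotZl (Vp i).2.
by rewrite -mulr_suml w1 mul1r.
Qed.

End Convexity.

(** * Face lattices and combinatorial cubes described by opposite facets *)

Section Faces.
Variable R : realType.
Implicit Types n : nat.

Lemma face_sub n (P F : set 'rV[R]_n) : face P F -> F `<=` P.
Proof. by move=> [c [b [_ ->]]] x []. Qed.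

Lemma face_set0 n (P : set 'rV[R]_n) : face P set0.
Proof.
exists 0, 1; split=> [x _|]; first by rewrite [leLHS]dot0r.
apply/seteqP; split=> // x [_ /=]; rewrite [LHS](dot0r x) => /eqP.
by rewrite eq_sym oner_eq0.
Qed.

Lemma face_refl n (P : set 'rV[R]_n) : face P P.
Proof.
exists 0, 0; split=> [x _|]; first by rewrite [leLHS]dot0r.
by apply/seteqP; split=> [x Px|x []//]; split=> //; rewrite /= [LHS]dot0r.
Qed.

(** The sum of the two supporting functionals reaches b + b' only where both reach their own
    bound. *)
Lemma faceI n (P F G : set 'rV[R]_n) : face P F -> face P G -> face P (F `&` G).
Proof.
move=> [c [b [Pc ->]]] [c' [b' [Pc' ->]]]; exists (c + c'), (b + b'); split.
  by move=> x Px; rewrite [leLHS]dotDr lerD ?Pc ?Pc'.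
apply/seteqP; split=> [x [[Px xb] [_ xb']]|x [Px /= xbb]].
  by split=> //=; rewrite [LHS]dotDr [X in X + _]xb [X in _ + X]xb'.
have xb := Pc x Px; have xb' := Pc' x Px; rewrite [LHS]dotDr in xbb.
by split; split=> //=; rewrite -!/(dot _ _) in xb xb' xbb *; lra.
Qed.

Lemma face_convex n (P F : set 'rV[R]_n) : convex P -> face P F -> convex F.
Proof.
move=> Pcvx [c [b [_ ->]]] x y a [Px xb] [Py yb] a01; split; first exact: Pcvx.
rewrite /= [LHS]dotDl !dotZl [X in _ * X + _]xb [X in _ + _ * X]yb.
by rewrite -mulrDl subrK mul1r.
Qed.

(** The mean of two values bounded by b equals b only if both do. *)
Lemma face_midpoint n (P F : set 'rV[R]_n) x y : face P F -> P x -> P y ->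
  F ((1 - 2^-1) *: x + 2^-1 *: y) -> F x /\ F y.
Proof.
move=> [c [b [Pc ->]]] Px Py [_ /=]; rewrite [LHS]dotDl !dotZl => xyb.
have xb := Pc x Px; have yb := Pc y Py.
by split; split=> //=; rewrite -!/(dot _ _) in xb yb *; lra.
Qed.

(* A face that escapes each of finitely many other faces has a point outside
   all of them: average witnesses. *)
Lemma face_generic_point n (P F : set 'rV[R]_n) (I : finType)
    (H : I -> set 'rV[R]_n) :
  convex P -> face P F -> (forall i, face P (H i)) -> F !=set0 ->
  exists2 p, F p & forall i, H i p -> F `<=` H i.
Proof.
move=> Pcvx FF HF F0.
suff [p Fp pH] : exists2 p, F p & forall i, i \in enum I -> H i p -> F `<=` H i.
  by exists p => // i; apply: pH; rewrite mem_enum.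
elim: (enum I) => [|i s [p Fp pH]]; first by case: F0 => p; exists p.
have [FH|] := pselect (F `<=` H i).
  by exists p => // j; rewrite inE => /predU1P[->//|]; apply: pH.
move=> /existsNP[q /not_implyP[Fq Hq]].
have Pp := face_sub FF Fp; have Pq := face_sub FF Fq.
exists ((1 - 2^-1) *: p + 2^-1 *: q).
  by apply: face_convex (Pcvx) (FF) _ _ _ Fp Fq _; lra.
move=> j /[1!inE] /predU1P[->|js] Hpq; have [Hp Hq'] := face_midpoint (HF _) Pp Pq Hpq.
  by have := Hq Hq'.
exact: pH Hp.
Qed.

(* A sign vector [s] names a face: [s j = Some b] puts it on the facet [H j b],
   and [s j = None] leaves the j-th coordinate free. *)
Definition cell n (P : set 'rV[R]_n) k (H : 'I_k -> bool -> set 'rV[R]_n)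
    (s : 'I_k -> option bool) : set 'rV[R]_n :=
  [set x | P x /\ forall j b, s j = Some b -> H j b x].

(* Opposite pairs of facets [H j false], [H j true] of a combinatorial k-cube. *)
Record cube_system n (P : set 'rV[R]_n) k (H : 'I_k -> bool -> set 'rV[R]_n) := {
  cs_convex : convex P;
  cs_face : forall j b, face P (H j b);
  cs_disjoint : forall j x, H j true x -> H j false x -> False;
  cs_pattern : forall s : 'I_k -> option bool,
    exists2 x, P x & forall j b, H j b x <-> s j = Some b;
  cs_extend : forall p x, P p -> P x -> (forall j b, H j b p -> H j b x) ->
    exists2 e, 0 < e & P (p + e *: (p - x)) }.

Section CubeSystem.
Variables (n : nat) (P : set 'rV[R]_n) (k : nat).
Variable (H : 'I_k -> bool -> set 'rV[R]_n).
Hypothesis cs : cube_system P H.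

(** A cell arises from P by intersecting with one facet for each fixed coordinate, so [faceI] is
    iterated along a list of the coordinates. *)
Lemma cell_face s : face P (cell P H s).
Proof.
have -> : cell P H s =
    [set x | P x /\ forall j, j \in enum 'I_k -> forall b, s j = Some b -> H j b x].
  apply/seteqP; split=> x [Px xH]; split=> // j b; first exact: xH.
  by apply: xH; rewrite mem_enum.
elim: (enum 'I_k) => [|j l IH].
  suff -> : [set x | P x /\ forall j, j \in [::] -> forall b, s j = Some b -> H j b x]
      = P.
    exact: face_refl.
  by apply/seteqP; split=> [x []|].
case sj : (s j) => [b|].
  rewrite (_ : mkset _ = H j b `&` [set x | P x /\
      forall j, j \in l -> forall b, s j = Some b -> H j b x]).
    by apply: faceI IH; apply: cs_face.
  apply/seteqP; split=> x.
    move=> [Px xH]; split; first by apply: (xH j); rewrite ?mem_head.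
    by split=> // i il; apply: xH; rewrite inE il orbT.
  move=> [Hx [Px xH]]; split=> // i /[1!inE] /predU1P[-> c|/xH//].
  by rewrite sj => -[<-].
rewrite (_ : mkset _ = [set x | P x /\
    forall j, j \in l -> forall b, s j = Some b -> H j b x])//.
apply/seteqP; split=> x [Px xH]; split=> // i.
  by move=> il; apply: xH; rewrite inE il orbT.
by rewrite inE => /predU1P[-> b|/xH//]; rewrite sj.
Qed.

Lemma cell_nonempty s : cell P H s !=set0.
Proof. by have [x Px xs] := cs_pattern cs s; exists x; split=> // j b /xs. Qed.

(** A point lying on exactly the facets prescribed by [s] detects every facet that contains the
    cell. *)
Lemma cell_subP s t :
  cell P H s `<=` cell P H t <-> (forall j b, t j = Some b -> s j = Some b).
Proof.
split=> [st j b tj|ts x [Px xs]]; last by split=> // j b /ts /xs.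
have [x Px xs] := cs_pattern cs s.
apply/xs; have [|_] := st x; first by split=> // i c /xs.
exact.
Qed.

(* The relative interior of F has a point p on no facet other than those
   containing F, and segments of the cell through p extend beyond p; the
   functional defining F is therefore constant on the cell. *)
Lemma face_cell F : face P F -> F !=set0 -> exists s, F = cell P H s.
Proof.
move=> FF F0.
pose s j := if asbool (F `<=` H j true) then Some true
            else if asbool (F `<=` H j false) then Some false else None.
have sP j b : s j = Some b <-> F `<=` H j b.
  rewrite /s; case: asboolP => [Ft|nFt].
    case: b; split=> //; case: F0 => x Fx Ff.
    by have := cs_disjoint cs (Ft _ Fx) (Ff _ Fx).
  by case: asboolP => Ff; case: b.
have [p Fp pH] : exists2 p, F p & forall i : 'I_k * bool,
    H i.1 i.2 p -> F `<=` H i.1 i.2.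
  by apply: face_generic_point (cs_convex cs) FF _ F0 => i; apply: cs_face.
have Pp := face_sub FF Fp.
exists s; apply/seteqP; split=> x.
  by move=> Fx; split; [exact: face_sub Fx|move=> j b /sP; apply].
move=> [Px xs]; have [|e e0 Pe] := cs_extend cs Pp Px.
  by move=> j b /(pH (j, b)) /sP /xs.
case: FF Fp => c [b [Pc ->]] [_ /= pb]; split=> //=.
have xb := Pc x Px; have eb := Pc _ Pe.
rewrite -!/(dot _ _) in pb xb eb *.
rewrite dotDl dotZl dotBl pb gerDl pmulr_rle0// in eb.
by apply/eqP; rewrite eq_le xb -subr_le0.
Qed.

End CubeSystem.

(** On both sides the nonempty faces are the cells, indexed and ordered by the same sign vectors. *)
Lemma cube_system_equiv n (P : set 'rV[R]_n) n' (P' : set 'rV[R]_n') k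
    (H : 'I_k -> bool -> set 'rV[R]_n) H' :
  cube_system P H -> @cube_system n' P' k H' -> comb_equiv P P'.
Proof.
move=> cs cs'.
(* Defining [f] through the facets containing F avoids choosing a sign vector. The empty face lies
   in every facet; the nonemptiness condition sends it to the empty face. *)
pose f (F : set 'rV[R]_n) : set 'rV[R]_n' :=
  [set x | F !=set0 /\ P' x /\ forall j b, F `<=` H j b -> H' j b x].
have f0 : f set0 = set0.
  by apply/seteqP; split=> // x [[y []]].
have cellH s j b : cell P H s `<=` H j b <-> s j = Some b.
  split=> [sH|sj x [_ /(_ j b sj)]//].
  have [x Px xs] := cs_pattern cs s; apply/xs/sH.
  by split=> // i c /xs.
have fc s : f (cell P H s) = cell P' H' s.
  apply/seteqP; split=> x [].
    by move=> _ [Px xs]; split=> // j b /cellH /xs.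
  move=> Px xs; split; first exact: cell_nonempty.
  by split=> // j b /cellH /xs.
have faceE F : face P F -> F = set0 \/ exists s, F = cell P H s.
  by move=> FF; have [->|/set0P F0] := eqVneq F set0; [left|right; exact: face_cell F0].
have ord F G : face P F -> face P G -> (f F `<=` f G <-> F `<=` G).
  move=> /faceE[->|[s ->]] /faceE[->|[t ->]]; rewrite ?f0 ?fc.
  - by split=> _ x.
  - by split=> _ x.
  - split=> st.
      by have [x /st] := cell_nonempty cs' s.
    by have [x /st] := cell_nonempty cs s.
  - by rewrite !cell_subP.
exists f; split=> //; split.
- move=> F /faceE[->|[s ->]]; rewrite ?f0 ?fc; first exact: face_set0.
  exact: cell_face.
- move=> F G /set_mem FF /set_mem FG fFG.
  by apply/seteqP; split; apply/ord => //; rewrite fFG.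
- move=> F FF; have [->|/set0P F0] := eqVneq F set0.
    by exists set0; [exact: face_set0|].
  have [s ->] := face_cell cs' FF F0.
  by exists (cell P H s); [exact: cell_face|].
Qed.

End Faces.

(** * Properties valid for all sufficiently small positive parameters *)

Section Small.
Variable R : realType.

(** Such properties are stable under finite conjunction, so one parameter can serve all sign vectors
    at once. *)
Definition small (Q : R -> Prop) :=
  exists2 d, 0 < d & forall e, 0 < e <= d -> Q e.

Lemma small_mono (Q Q' : R -> Prop) :
  (forall e, 0 < e -> Q e -> Q' e) -> small Q -> small Q'.
Proof.
move=> QQ' [d d0 Qd]; exists d => // e ed; apply: QQ'; last exact: Qd.
by case/andP: ed.
Qed.

Lemma small_and (Q Q' : R -> Prop) :
  small Q -> small Q' -> small (fun e => Q e /\ Q' e).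
Proof.
move=> [d d0 Qd] [d' d'0 Qd']; exists (Num.min d d').
  by rewrite lt_min d0.
move=> e; rewrite le_min => /and3P[e0 ed ed'].
by split; [apply: Qd|apply: Qd']; rewrite e0.
Qed.

Lemma small_forall (I : finType) (Q : I -> R -> Prop) :
  (forall i, small (Q i)) -> small (fun e => forall i, Q i e).
Proof.
move=> sQ; suff : small (fun e => forall i, i \in enum I -> Q i e).
  by apply: small_mono => e _ Qe i; apply: Qe; rewrite mem_enum.
elim: (enum I) => [|i s IH]; first by exists 1.
apply: small_mono (small_and (sQ i) IH) => e _ [Qi Qs] j.
by rewrite inE => /predU1P[->//|/Qs].
Qed.

Lemma small_ex (Q : R -> Prop) : small Q -> exists2 e, 0 < e & Q e.
Proof. by move=> [d d0 Qd]; exists d => //; apply: Qd; rewrite d0 lexx. Qed.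

(** Write p = p(0) + X q and let M be the sum of the absolute values of the coefficients of q. Once
    e <= 1 and e (M + 1) <= p(0) / 2, the remainder is at most p(0) / 2 in absolute value. *)
Lemma small_poly_gt0 (p : {poly R}) : 0 < p.[0] -> small (fun e => 0 < p.[e]).
Proof.
move=> p0; have /factor_theorem[q pq] : root (p - p.[0]%:P) 0.
  by rewrite /root !hornerE subrr.
pose M := \sum_(i < size q) `|q`_i|.
have M0 : 0 <= M by apply: sumr_ge0.
exists (Num.min 1 (p.[0] / (M + 1) / 2)).
  by rewrite lt_min ltr01 !divr_gt0// ltr_wpDl.
move=> e; rewrite le_min => /and3P[e0 e1 eM].
have -> : p.[e] = p.[0] + q.[e] * e.
  rewrite -{1}(subrK p.[0]%:P p) pq !hornerE subr0.
    by rewrite addrC.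
have qM : `|q.[e]| <= M.
  rewrite horner_coef; apply: le_trans (ler_norm_sum _ _ _) _.
  apply: ler_sum => i _; rewrite normrM ler_piMr// normrX exprn_ile1//.
  by rewrite ger0_norm// ltW.
have eM' : e * (M + 1) <= p.[0] / 2.
  by rewrite -ler_pdivlMr ?ltr_wpDl// mulrAC.
have /ler_normlP[qe _] := qM.
nra.
Qed.

Lemma small_affine_lt0 (a b : R) : a < 0 -> small (fun e => a + e * b < 0).
Proof.
move=> a0; have : 0 < (- a%:P - b%:P * 'X).[0].
  by rewrite !hornerE; lra.
move=> /small_poly_gt0; apply: small_mono => e _; rewrite !hornerE; lra.
Qed.

(** This lets a point move a little in a direction along which its tight constraints stay
    constant. *)
Lemma small_affine_le0 (a b : R) : a <= 0 -> (a = 0 -> b = 0) ->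
  small (fun e => a + e * b <= 0).
Proof.
rewrite le_eqVlt => /predU1P[-> /(_ erefl) ->|a0 _].
  by exists 1 => // e _; rewrite mulr0 addr0.
by apply: small_mono (small_affine_lt0 b a0) => e _ /ltW.
Qed.

End Small.

(** * The standard cube *)

Section StdCube.
Variables (R : realType) (k : nat).

Definition std_facet (j : 'I_k) (b : bool) : set 'rV[R]_k :=
  [set x | std_cube x /\ x ord0 j = b%:R].

Lemma std_cube_system : cube_system (@std_cube R k) std_facet.
Proof.
split.
- move=> x y a xP yP a01 i; rewrite !mxE.
  by have := xP i; have := yP i; nra.
(* The facet x_j = 0 comes from -x_j <= 0 and the facet x_j = 1 from x_j <= 1. *)
- move=> j b; pose c : 'cV[R]_k := (-1) ^+ (~~ b) *: delta_mx j 0.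
  exists c, b%:R.
  have dotE (x : 'rV[R]_k) : (x *m c) ord0 ord0 = (-1) ^+ (~~ b) * x ord0 j.
    by rewrite -scalemxAr -colE !mxE.
  split=> [x /(_ j)|]; first by rewrite dotE; case: (b) => /=; lra.
  apply/seteqP; split=> x [Px /=]; rewrite dotE => xj.
    by split=> //=; rewrite xj; case: (b) => /=; lra.
  by split=> //; move: xj; case: (b) => /=; lra.
- by move=> j x [_ /= xj1] [_ /=]; rewrite xj1 => /eqP; rewrite oner_eq0.
(* The value 1/2 keeps a free coordinate off both of its facets. *)
- move=> s; exists (\row_j oapp (fun b : bool => b%:R) 2^-1 (s j)).
    by move=> i; rewrite mxE; case: (s i) => [[]|] /=; lra.
  move=> j b; rewrite /std_facet /=; split=> [[_]|sj].
    by rewrite mxE; case: (s j) => [[]|]; case: b => //= E; exfalso; lra.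
  split; last by rewrite mxE sj.
  by move=> i; rewrite mxE; case: (s i) => [[]|] /=; lra.
- move=> p x Pp Px tight.
  have [e e0 He] : exists2 e, 0 < e & forall j,
      (- p ord0 j + e * - (p ord0 j - x ord0 j) <= 0) /\
      ((p ord0 j - 1) + e * (p ord0 j - x ord0 j) <= 0).
    apply/small_ex/small_forall => j.
    have := Pp j; have := Px j; have := tight j => tj pj xj.
    apply: small_and; apply: small_affine_le0; try lra.
      move=> pj0; have [|_ ->] := tj false; first by split=> //=; lra.
      by rewrite /=; lra.
    move=> pj0; have [|_ ->] := tj true; first by split=> //=; lra.
    by rewrite /=; lra.
  exists e => // i; rewrite !mxE; have := He i; lra.
Qed.

Lemma cube_system_comb_cube n (P : set 'rV[R]_n) (H : 'I_k -> bool -> set 'rV[R]_n) :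
  polytope P -> cube_system P H -> comb_cube k P.
Proof. by move=> pP cs; split=> //; apply: cube_system_equiv cs std_cube_system. Qed.

End StdCube.

(** * Dimension of affine hulls *)

Section Dimension.
Variable R : realType.

Lemma has_dim_param d k (S : set 'rV[R]_d) x (A : 'M[R]_(k, d)) :
  row_free A -> aff_hull S = [set x + w *m A | w in setT] -> has_dim S k.
Proof.
move=> Afree SE; pose f : 'Hom('rV[R]_k, 'rV[R]_d) := linfun (mulmxr A).
exists x, (limg f); split.
  rewrite limg_dim_eq ?dimvf ?dim_matrix; first exact: mul1n.
  apply/eqP; rewrite -subv0; apply/subvP => w; rewrite memv_cap memv_ker lfunE /=.
  move=> /andP[_ /eqP wA]; rewrite memv0; apply/eqP/(row_free_inj Afree).
  by rewrite mul0mx.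
rewrite SE; apply/seteqP; split=> [_ [w _ <-]|_ [u /= /memv_imgP[w _ ->] <-]].
  by exists (w *m A) => //=; apply/memv_imgP; exists w; rewrite ?memvf// lfunE.
by exists w => //; rewrite lfunE.
Qed.

(** Two translates x + U and x' + U' coincide only if U = U', so the dimension is well defined. *)
Lemma has_dim_inj d k k' (S : set 'rV[R]_d) : has_dim S k -> has_dim S k' -> k = k'.
Proof.
have mem x (U : {vspace 'rV[R]_d}) x' (U' : {vspace 'rV[R]_d}) :
    [set x + u | u in [set u | u \in U]] = [set x' + u | u in [set u | u \in U']] ->
    (U <= U')%VS.
  move=> e; have sub u : u \in U -> exists2 u', u' \in U' & x + u = x' + u'.
    move=> uU; have : [set x + u | u in [set u | u \in U]] (x + u) by exists u.
    by rewrite e => -[u' uU' <-]; exists u'.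
  have [z zU' xz] := sub 0 (mem0v _).
  apply/subvP => u /sub[u' u'U' xu]; rewrite addr0 in xz.
  suff -> : u = u' - z by rewrite memvB.
  by apply: (addrI x); rewrite xu xz addrACA subrr addr0 addrC.
move=> [x [U [<- SE]]] [x' [U' [<- SE']]]; congr (\dim _).
by apply/eqP; rewrite eqEsubv (mem _ _ _ _ (etrans (esym SE) SE'))
  (mem _ _ _ _ (etrans (esym SE') SE)).
Qed.

Lemma has_dim_nonempty d k (S : set 'rV[R]_d) : has_dim S k -> S !=set0.
Proof.
move=> [x [U [_ SE]]]; have : aff_hull S x.
  by rewrite SE; exists 0; rewrite ?addr0//= mem0v.
move=> [[|m] [p [w [Sp w1 _]]]]; last by exists (p ord0).
by move: w1; rewrite big_ord0 => /eqP; rewrite eq_sym oner_eq0.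
Qed.

End Dimension.

(** * Deformed cubes: coordinates, vertices, faces and their directions *)

(* The cube is [{x | eps |x_i| <= slack x i}], where [slack x i] only involves
   the coordinates before [i]. *)
Section DeformedCube.
Variables (R : realType) (n : nat) (eps : R) (B : 'M[R]_n) (c : 'rV[R]_n).
Hypothesis eps_gt0 : 0 < eps.
Hypothesis B_strict : forall j i : 'I_n, (i <= j)%N -> B j i = 0.

Definition slack (x : 'rV[R]_n) i : R := c ord0 i - (x *m B) ord0 i.

(** The absolute value on the right makes this applicable to points for which the signs of the
    slacks are not yet known, such as those of [solution_dcube]. *)
Hypothesis slack_gt0 : forall x : 'rV[R]_n,
  (forall i, eps * `|x ord0 i| <= `|slack x i|) -> forall i, 0 < slack x i.

(** The value 0 at [None] turns a sign vector into parameters in {-1, 0, 1} for [solution]. *)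
Definition sg (o : option bool) : R :=
  if o is Some b then (-1) ^+ (~~ b) else 0.

Definition normal i b : 'cV[R]_n := (sg (Some b) * eps) *: delta_mx i 0 + col i B.

Lemma dot_normal x i b :
  dot x (normal i b) = sg (Some b) * (eps * x ord0 i) + (x *m B) ord0 i.
Proof.
by rewrite /dot /normal mulmxDr -scalemxAr -colE (colE i B) mulmxA -colE !mxE mulrA.
Qed.

Definition dcube : set 'rV[R]_n :=
  [set x : 'rV[R]_n | forall i, eps * `|x ord0 i| <= slack x i].

Lemma dcubeP x : dcube x <-> forall i b, dot x (normal i b) <= c ord0 i.
Proof.
split=> Cx i; last first.
  have := Cx i true; have := Cx i false; rewrite !dot_normal /sg /slack /=.
  by case: (ger0P (x ord0 i)); lra.
move=> b; have := Cx i; rewrite dot_normal /slack => xi.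
have : sg (Some b) * x ord0 i <= `|x ord0 i|.
  by case: b => /=; rewrite ?expr0 ?expr1 ?mul1r ?mulN1r ?ler_norm// -normrN ler_norm.
by rewrite -(ler_pM2l eps_gt0) mulrCA; lra.
Qed.

Definition dfacet i b : set 'rV[R]_n :=
  [set x | dcube x /\ dot x (normal i b) = c ord0 i].

Lemma slack_prefix (x x' : 'rV[R]_n) (i : 'I_n) :
  (forall j : 'I_n, (j < i)%N -> x ord0 j = x' ord0 j) -> slack x i = slack x' i.
Proof.
move=> xx'; rewrite /slack !mxE; congr (_ - _); apply: eq_bigr => j _.
by case: (ltnP j i) => [/xx'->//|/B_strict->]; rewrite !mulr0.
Qed.

Lemma slack_affine x x' a i :
  slack ((1 - a) *: x + a *: x') i = (1 - a) * slack x i + a * slack x' i.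
Proof. by rewrite /slack mulmxDl -!scalemxAl !mxE; ring. Qed.

Lemma dcube_slack_gt0 x i : dcube x -> 0 < slack x i.
Proof.
by move=> Cx; apply: slack_gt0 => j; apply: le_trans (Cx j) (ler_norm _).
Qed.

(** The parameters y in [-1, 1]^n are cube coordinates on [dcube]: y_i = 1 means lying on
    [dfacet i true], and y_i = -1 on [dfacet i false]. *)
Definition solution (y : 'I_n -> R) (x : 'rV[R]_n) :=
  forall i, eps * x ord0 i = y i * slack x i.

(** For fixed y, being a solution is a linear system with this matrix and right-hand side y_i
    c_i. *)
Definition sysmx (y : 'I_n -> R) : 'M[R]_n := eps%:M + B *m diag_mx (\row_i y i).

Lemma mul_sysmx y (x : 'rV[R]_n) i :
  (x *m sysmx y) ord0 i = eps * x ord0 i + (x *m B) ord0 i * y i.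
Proof. by rewrite mulmxDr mul_mx_scalar mulmxA mul_mx_diag !mxE. Qed.

Lemma sysmxE y j i : sysmx y j i = eps *+ (j == i) + B j i * y i.
Proof. by rewrite /sysmx mul_mx_diag !mxE. Qed.

(** The matrix is triangular with eps on the diagonal, because B is strictly triangular. *)
Lemma sysmx_unit y : sysmx y \in unitmx.
Proof.
have trigT : is_trig_mx (sysmx y)^T.
  apply/is_trig_mxP => i j ij; rewrite mxE sysmxE (B_strict (ltnW ij)).
  by rewrite mul0r addr0 -val_eqE /= gtn_eqF.
rewrite unitmxE -det_tr det_trig// unitfE; apply/prodf_neq0 => i _.
by rewrite mxE sysmxE eqxx (B_strict (leqnn i)) mul0r addr0 gt_eqF.
Qed.

Lemma solution_exists y : exists x, solution y x.
Proof.
exists ((\row_i (y i * c ord0 i)) *m invmx (sysmx y)) => i.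
set x := _ *m _; have : x *m sysmx y = \row_i (y i * c ord0 i).
  by rewrite mulmxKV// sysmx_unit.
move=> /rowP/(_ i); rewrite mul_sysmx mxE /slack; lra.
Qed.

(** The i-th equation determines x_i from y_i and the earlier coordinates, whence a strong
    induction. *)
Lemma solution_prefix y y' (x x' : 'rV[R]_n) (k : nat) :
  solution y x -> solution y' x' -> (forall j : 'I_n, (j < k)%N -> y j = y' j) ->
  forall j : 'I_n, (j < k)%N -> x ord0 j = x' ord0 j.
Proof.
move=> sx sx' yy' j; have [m jm] := ubnP (val j).
elim: m j jm => // m IH j jm jk; apply: (mulfI (lt0r_neq0 eps_gt0)).
rewrite sx sx' yy'//; congr (_ * _); apply: slack_prefix => i ij.
apply: IH; first exact: leq_trans ij jm.
exact: ltn_trans ij jk.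
Qed.

Lemma solution_uniq y x x' : solution y x -> solution y x' -> x = x'.
Proof.
by move=> sx sx'; apply/rowP => i; apply: (solution_prefix sx sx' (k := n)).
Qed.

Lemma solution_dcube y x : (forall i, `|y i| <= 1) -> solution y x -> dcube x.
Proof.
move=> y1 sx; have xe i : eps * `|x ord0 i| = `|y i| * `|slack x i|.
  by rewrite -normrM -sx normrM gtr0_norm.
have sl i : 0 < slack x i.
  by apply: slack_gt0 => j; rewrite xe ler_piMl.
by move=> i; rewrite xe (gtr0_norm (sl i)) ler_piMl// ltW.
Qed.

Lemma dcube_solution x : dcube x -> exists2 y, (forall i, `|y i| <= 1) & solution y x.
Proof.
move=> Cx; have sl i : 0 < slack x i by apply: dcube_slack_gt0.
exists (fun i => eps * x ord0 i / slack x i) => i; last by rewrite divfK// gt_eqF.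
rewrite normrM normfV (gtr0_norm (sl i)) ler_pdivrMr// mul1r normrM.
by rewrite gtr0_norm.
Qed.

Lemma dcube_convex : convex dcube.
Proof.
move=> x y a /dcubeP Cx /dcubeP Cy a01; apply/dcubeP => i b.
rewrite dotDl !dotZl; have := Cx i b; have := Cy i b; nra.
Qed.

(* The solution is affine in each single parameter [y i], so pushing the
   parameters to 1 or -1 one at a time reaches the vertices. *)
Lemma solution_split y x i : solution y x -> `|y i| <= 1 ->
  forall x1 x2,
    solution (fun j => if j == i then 1 else y j) x1 ->
    solution (fun j => if j == i then -1 else y j) x2 ->
  x = (1 - (1 + y i) / 2) *: x2 + ((1 + y i) / 2) *: x1.
Proof.
move=> sx yi x1 x2 s1 s2; apply: (solution_uniq sx) => j.
rewrite slack_affine !mxE; have := s1 j; have := s2 j.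
case: eqVneq => [->|_ e2 e1]; last first.
  by rewrite mulrDr mulrCA [X in _ + X]mulrCA e1 e2; ring.
have -> : slack x2 i = slack x1 i.
  apply: slack_prefix => k ki; apply: solution_prefix s2 s1 _ _ ki => l li.
  by rewrite -!val_eqE /= ltn_eqF.
move=> e2 e1; rewrite mulrDr mulrCA [X in _ + X]mulrCA e1 e2; lra.
Qed.

Lemma dcube_polytope : polytope dcube.
Proof.
have /choice[xs xsP] : forall f : {ffun 'I_n -> bool},
    exists x, solution (fun i => sg (Some (f i))) x.
  by move=> f; apply: solution_exists.
exists (range xs); first exact/finite_image/finite_finset.
have sg1 b : `|sg (Some b)| = 1 by rewrite /= normrX normrN1 expr1n.
apply/seteqP; split=> [x Cx|x [m [p [w [Vp w0 w1 ->]]]]]; last first.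
  apply/dcubeP => i b; rewrite dot_suml -[leRHS]mul1r -w1 mulr_suml.
  apply: ler_sum => j _; rewrite dotZl ler_wpM2l//.
  have [f _ <-] := Vp j; apply: (dcubeP _).1.
  by apply: solution_dcube (xsP f) => l; rewrite sg1.
have [y y1 sx] := dcube_solution Cx.
(* Induction on the number of parameters different from 1 and -1; when there are none, x is one of
   the vertices [xs f]. *)
have [m le_m] := ubnP #|[pred i | `|y i| != 1]|.
elim: m => // m IH in y x y1 sx le_m {Cx} *.
have [/existsP[i yi]|] := boolP [exists i, `|y i| != 1]; last first.
  rewrite negb_exists => /forallP y1'; apply: conv_hull_sub.
  exists [ffun i => 0 <= y i] => //; apply: solution_uniq (xsP _) _.
  move=> j; rewrite sx ffunE; congr (_ * _); have := y1' j; rewrite negbK => /eqP.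
  by case: ger0P => /= _; lra.
pose y' b j := if j == i then sg (Some b) else y j.
have y'1 b j : `|y' b j| <= 1 by rewrite /y'; case: ifP => _; rewrite ?sg1.
have y'm b : (#|[pred j | (`|y' b j| != 1)%R]| < m)%N.
  rewrite -ltnS; apply: leq_trans le_m; rewrite ltnS; apply: proper_card.
  apply/properP; split.
    apply/fintype.subsetP => j; rewrite !inE /y'.
    have [_|//] := eqVneq j i. by rewrite sg1 eqxx.
  by exists i; rewrite !inE // /y' eqxx sg1 eqxx.
have [x1 s1] := solution_exists (y' true).
have [x2 s2] := solution_exists (y' false).
rewrite (solution_split (i := i) sx (y1 i) (x1 := x1) (x2 := x2)); first last.
- by move=> j; rewrite s2 /y' /= expr1.
- by move=> j; rewrite s1 /y' /= expr0.
apply: conv_hull_convex.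
- exact: IH s2 (y'm false).
- exact: IH s1 (y'm true).
- by have := y1 i; rewrite ler_norml; lra.
Qed.

(** Tight constraints are constant along v, and the others leave room for a short move. *)
Lemma dcube_extend p v : dcube p ->
  (forall i b, dfacet i b p -> dot v (normal i b) = 0) ->
  exists2 e, 0 < e & dcube (p + e *: v).
Proof.
move=> Cp vp; have Cp' := (dcubeP _).1 Cp.
have [e e0 He] : exists2 e, 0 < e & forall ib : 'I_n * bool,
    (dot p (normal ib.1 ib.2) - c ord0 ib.1) + e * dot v (normal ib.1 ib.2) <= 0.
  apply/small_ex/small_forall => -[i b] /=; apply: small_affine_le0.
    by rewrite subr_le0.
  by move=> /subr0_eq pib; apply: vp.
exists e => //; apply/dcubeP => i b; rewrite dotDl dotZl.
by have := He (i, b) => /=; lra.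
Qed.

(** Since slacks are positive, parameter 0 avoids both i-th facets, while 1 and -1 each select
    exactly one of them. *)
Lemma solution_pattern (s : 'I_n -> option bool) x i b :
  solution (fun i => sg (s i)) x -> dfacet i b x <-> s i = Some b.
Proof.
move=> sx; have Cx : dcube x.
  apply: solution_dcube sx => j; case: (s j) => [b'|] /=; rewrite ?normr0//.
  by rewrite normrX normrN1 expr1n.
have := dcube_slack_gt0 i Cx; have := sx i.
rewrite /dfacet /= dot_normal /slack => -> sl; set z := _ - _ in sl *.
split=> [[_ e]|->]; last first.
  by split=> //; rewrite mulrA -expr2 sqrr_sign mul1r /z; lra.
have {}e : sg (Some b) * (sg (s i) * z) = z by rewrite /z in e *; lra.
by move: e; case: (s i) => [[]|]; case: (b) => // e; exfalso; move: e => /=; lra.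
Qed.

Lemma dcube_system : cube_system dcube dfacet.
Proof.
split.
- exact: dcube_convex.
- move=> i b; exists (normal i b), (c ord0 i); split=> [x /dcubeP|//].
  by apply.
- move=> i x [Cx xt] [_ xf]; have := dcube_slack_gt0 i Cx.
  by rewrite !dot_normal /= in xt xf; rewrite /slack; lra.
- move=> s; have [x sx] := solution_exists (fun i => sg (s i)).
  exists x; last by move=> i b; apply: solution_pattern.
  apply: solution_dcube sx => j; case: (s j) => [b'|] /=; rewrite ?normr0//.
  by rewrite normrX normrN1 expr1n.
- move=> p x Cp Cx px; apply: dcube_extend => // i b pib.
  by have [_ xib] := px i b pib; have [_ pib'] := pib; rewrite dotBl xib pib' subrr.
Qed.

Notation dcell := (cell dcube dfacet).

(** The linear space parallel to the affine hull of the cell of [s]. *)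
Definition direction (s : 'I_n -> option bool) (v : 'rV[R]_n) :=
  forall i b, s i = Some b -> dot v (normal i b) = 0.

Definition free (s : 'I_n -> option bool) : pred 'I_n := [pred i | ~~ isSome (s i)].

Lemma in_free s i : (i \in free s) = ~~ isSome (s i).
Proof. by []. Qed.

Lemma dcell_sub s x y : dcell s x -> dcell s y -> direction s (x - y).
Proof.
by move=> [_ xs] [_ ys] i b si; rewrite dotBl (xs _ _ si).2 (ys _ _ si).2 subrr.
Qed.

Lemma dcell_extend s : exists2 p, dcell s p &
  forall v, direction s v -> exists2 e, 0 < e & dcell s (p + e *: v).
Proof.
have [p Cp ps] := cs_pattern dcube_system s.
have sp : dcell s p by split=> // i b /ps.
exists p => // v sv; have [i b /ps /sv//|e e0 Ce] := @dcube_extend p v Cp.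
exists e => //; split=> // i b si; split=> //.
by rewrite dotDl dotZl (sv _ _ si) mulr0 addr0; have [] := (ps i b).2 si.
Qed.

Lemma dcell_normal_vanish s u b : (forall x, dcell s x -> dot x u = b) ->
  forall v, direction s v -> dot v u = 0.
Proof.
move=> su v sv; have [p sp /(_ v sv)[e e0 spe]] := dcell_extend s.
have := su _ spe; rewrite dotDl dotZl su// => /eqP.
by rewrite -subr_eq0 addrAC subrr add0r mulf_eq0 gt_eqF//= => /eqP.
Qed.

(** Allowing an arbitrary Q covers the cells themselves, their injective projections and the
    projection of the whole cube. *)
Lemma aff_hull_dcell s d (Q : 'M[R]_(n, d)) : exists p,
  aff_hull [set x *m Q | x in dcell s] =
  [set p *m Q + v *m Q | v in direction s].
Proof.
have [p sp spe] := dcell_extend s; exists p.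
apply/seteqP; split=> [_ [m [q [w [qs w1 ->]]]]|_ [v sv <-]].
  have /choice[x xs] : forall i, exists x, dcell s x /\ x *m Q = q i.
    by move=> i; have [x] := qs i; exists x.
  exists (\sum_i w i *: (x i - p)).
    move=> i b si; rewrite dot_suml big1// => j _; rewrite dotZl.
    by rewrite (dcell_sub (xs j).1 sp si) mulr0.
  rewrite -mulmxDl; under eq_bigr do rewrite scalerBr.
  rewrite sumrB -scaler_suml w1 scale1r addrC subrK mulmx_suml.
  by apply: eq_bigr => i _; rewrite -scalemxAl (xs i).2.
have [e e0 sq] := spe v sv.
(* The step e v stays in the cell; the affine weights 1 - 1/e and 1/e rescale it to v. *)
exists 2%N, (fun i => if i == ord0 then p *m Q else (p + e *: v) *m Q),
  (fun i => if i == ord0 then 1 - e^-1 else e^-1); split.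
- by move=> i; case: ifP => _; [exists p|exists (p + e *: v)].
- by rewrite big_ord_recl big_ord1 /= subrK.
rewrite big_ord_recl big_ord1 /= mulmxDl scalerDr addrA -scalerDl subrK scale1r.
by rewrite -scalemxAl scalerA mulVf ?gt_eqF// scale1r.
Qed.

(** Multiplication by the invertible matrix [M] turns the equations of [direction s] into the
    vanishing of the entries fixed by [s]; the free entries then serve as parameters. *)
Lemma direction_param s : exists2 A : 'M[R]_(#|free s|, n), row_free A &
  forall v, direction s v <-> exists w, v = w *m A.
Proof.
pose M := sysmx (fun i => sg (s i)); have Mu : M \in unitmx := sysmx_unit _.
pose E : 'M[R]_(#|free s|, n) := \matrix_(a, i) (enum_val a == i)%:R.
have wE (w : 'rV_#|free s|) a : (w *m E) ord0 (enum_val a) = w ord0 a.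
  rewrite mxE (bigD1 a)//= mxE eqxx mulr1 big1 ?addr0// => a' /negPf a'a.
  by rewrite mxE (inj_eq enum_val_inj) a'a mulr0.
have dirE v : direction s v <-> forall i, s i -> (v *m M) ord0 i = 0.
  split=> [sv i si|vM i b si].
    move: (sv i); rewrite mul_sysmx; case: (s i) si => // b _ /(_ b erefl).
    rewrite dot_normal => /(congr1 ( *%R (sg (Some b)))).
    by rewrite mulr0 mulrDr mulrA -expr2 sqrr_sign mul1r [_ * (_ *m _) _ _]mulrC.
  have := vM i; rewrite mul_sysmx si => /(_ isT) /(congr1 ( *%R (sg (Some b)))).
  rewrite mulr0 dot_normal mulrDr [_ * (_ * sg _)]mulrCA -expr2 sqrr_sign mulr1.
  by [].
exists (E *m invmx M).
  apply: inj_row_free => w; rewrite mulmxA => /(congr1 (mulmx^~ M)).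
  rewrite mulmxKV// mul0mx => wE0; apply/rowP => a.
  by rewrite -wE wE0 !mxE.
move=> v; rewrite dirE; split=> [vM|[w ->] i si].
  exists (\row_a (v *m M) ord0 (enum_val a)).
  rewrite mulmxA; apply: (canRL (mulmxK Mu)); apply/rowP => i.
  have [si|si] := boolP (isSome (s i)).
    rewrite vM// mxE big1// => a _; rewrite !mxE.
    case: eqVneq => [ai|]; last by rewrite mulr0.
    by have := enum_valP a; rewrite ai in_free si.
  have fi : i \in free s by [].
  have := wE (\row_a (v *m M) ord0 (enum_val a)) (enum_rank_in fi i).
  by rewrite [RHS]mxE enum_rankK_in.
rewrite mulmxA mulmxKV// mxE big1// => a _; rewrite mxE.
case: eqVneq => [ai|]; last by rewrite mulr0.
by have := enum_valP a; rewrite ai in_free si.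
Qed.

(** * Projections that are injective on the directions of a cell *)

Section Projection.
Variables (s : 'I_n -> option bool) (d : nat) (Q : 'M[R]_(n, d)).
Hypothesis Q_inj : forall v, direction s v -> v *m Q = 0 -> v = 0.

Lemma dcell_proj_inj x y : dcell s x -> dcell s y -> x *m Q = y *m Q -> x = y.
Proof.
move=> sx sy xy; apply/subr0_eq/Q_inj; first exact: dcell_sub.
by rewrite mulmxBl xy subrr.
Qed.

Lemma direction_proj_param : exists2 A : 'M[R]_(#|free s|, n),
  row_free (A *m Q) & forall v, direction s v <-> exists w, v = w *m A.
Proof.
have [A Afree AP] := direction_param s; exists A => //.
apply: inj_row_free => w; rewrite mulmxA => /Q_inj wA.
apply: (row_free_inj Afree); rewrite mul0mx; apply: wA.
by apply/AP; exists w.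
Qed.

(** A linear inverse of the projection on directions, through which facet functionals are
    transported to the image. *)
Lemma direction_retract : exists Q' : 'M[R]_(d, n),
  forall v, direction s v -> v *m Q *m Q' = v.
Proof.
have [A /row_freeP[D AQD] AP] := direction_proj_param. exists (D *m A) => v /AP[w ->].
have -> : w *m A *m Q *m (D *m A) = w *m (A *m Q *m D) *m A by rewrite !mulmxA.
by rewrite AQD mulmx1.
Qed.

Lemma has_dim_dcell_proj : has_dim [set x *m Q | x in dcell s] #|free s|.
Proof.
have [A AQfree AP] := direction_proj_param; have [p hullE] := aff_hull_dcell s Q.
apply: (has_dim_param (x := p *m Q) AQfree).
rewrite hullE; apply/seteqP; split=> [_ [v /AP[w ->] <-]|_ [w _ <-]].
  by exists w => //; rewrite mulmxA.
by exists (w *m A); rewrite ?mulmxA//; apply/AP; exists w.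
Qed.

(** The projection is injective on the cell, so the image inherits the pairs of opposite facets at
    the free coordinates. *)
Lemma dcell_proj_system : cube_system [set x *m Q | x in dcell s]
  (fun (j : 'I_#|free s|) b =>
     [set x *m Q | x in dcell s `&` dfacet (enum_val j) b]).
Proof.
have [Q' Q'P] := direction_retract.
have scell : face dcube (dcell s) := cell_face dcube_system s.
split.
- move=> _ _ a [x sx <-] [y sy <-] a01; exists ((1 - a) *: x + a *: y).
    exact: face_convex dcube_convex scell _ _ _ sx sy a01.
  by rewrite mulmxDl -!scalemxAl.
- move=> j b; set i := enum_val j; have [p sp] := cell_nonempty dcube_system s.
  (* [Q'] inverts the projection only on differences of points of the cell, so values are compared
     with those at the base point [p]. *)
  have dotE x : dcell s x -> dot (x *m Q) (Q' *m normal i b) =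
      dot x (normal i b) - dot p (normal i b) + dot (p *m Q *m Q') (normal i b).
    move=> sx; rewrite -dot_mulmx -dotBl -dotDl -[in LHS](subrK p x).
    by rewrite mulmxDl mulmxDl Q'P//; apply: dcell_sub.
  exists (Q' *m normal i b),
    (c ord0 i - dot p (normal i b) + dot (p *m Q *m Q') (normal i b)); split.
    move=> _ [x sx <-]; rewrite [leLHS]dotE// !lerD2r.
    by apply: (dcubeP _).1; case: sx.
  apply/seteqP; split=> [_ [x [sx [Cx xi]] <-]|_ [[x sx <-] /=]].
    by split; [exists x|rewrite /= [LHS]dotE// xi].
  rewrite [X in X = _ -> _]dotE// => /addIr/addIr xi; exists x => //.
  by split=> //; split=> //; case: sx.
- move=> j _ [x [sx xt] <-] [y [sy yf] /(dcell_proj_inj sy sx) yx].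
  by move: yf; rewrite yx; apply: (cs_disjoint dcube_system xt).
- move=> t.
  (* [s'] follows [s] where it is fixed and [t] on the free coordinates. *)
  pose s' i := if s i is Some b then Some b
               else obind t [pick j : 'I_#|free s| | enum_val j == i].
  have [x Cx xs'] := cs_pattern dcube_system s'.
  have sx : dcell s x by split=> // i b si; apply/xs'; rewrite /s' si.
  have s't j : s' (enum_val j) = t j.
    rewrite /s'; have := enum_valP j; rewrite in_free; case: (s _) => // _.
    by case: pickP => [j' /eqP/enum_val_inj->//|/(_ j)]; rewrite eqxx.
  exists (x *m Q); first by exists x.
  move=> j b; rewrite -s't -xs'; split; last by exists x.
  by move=> [y [sy yf] /(dcell_proj_inj sy sx) <-].
- move=> _ _ [p sp <-] [x sx <-] px.
  have [|e e0 Ce] := cs_extend dcube_system sp.1 sx.1.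
    move=> i b pib; case si : (s i) => [b'|].
      suff <- : b' = b by apply: sx.2.
      have := sp.2 _ _ si; case: b b' pib {si} => [] [] // h h'; exfalso.
        exact: (cs_disjoint dcube_system h h').
      exact: (cs_disjoint dcube_system h' h).
    have fi : i \in free s by rewrite in_free si.
    have [|y [sy yf] yx] := px (enum_rank_in fi i) b.
      by exists p => //; split=> //; rewrite enum_rankK_in.
    by move: yf; rewrite (dcell_proj_inj sy sx yx) enum_rankK_in.
  exists e => //; exists (p + e *: (p - x)).
    split=> // i b si; split=> //; rewrite dotDl dotZl.
    by rewrite (dcell_sub sp sx si) mulr0 addr0; have [] := sp.2 _ _ si.
  by rewrite mulmxDl -scalemxAl mulmxBl.
Qed.

Lemma dcell_proj_comb_cube : comb_cube #|free s| [set x *m Q | x in dcell s].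
Proof.
apply: cube_system_comb_cube dcell_proj_system; apply: image_polytope.
exact: face_polytope dcube_polytope (cell_face dcube_system s).
Qed.

End Projection.

End DeformedCube.

(** * Choice of the right-hand sides of the facet inequalities *)

Section SlackBound.
Variables (R : realType) (n : nat) (eps : R) (B : 'M[R]_n).
Hypothesis eps_gt0 : 0 < eps.
Hypothesis B_strict : forall j i : 'I_n, (i <= j)%N -> B j i = 0.

(** With c_i = 2 b K^i growing geometrically, induction gives |x_j| <= K^(j+1). Hence the i-th entry
    of x B is at most b K^i in absolute value, which is less than c_i. *)
Lemma slack_gt0_exists : exists c : 'rV[R]_n, forall x : 'rV[R]_n,
  (forall i, eps * `|x ord0 i| <= `|slack B c x i|) -> forall i, 0 < slack B c x i.
Proof.
pose b : R := 1 + \sum_i \sum_j `|B j i|.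
have b_ge (i : 'I_n) : \sum_j `|B j i| <= b.
  rewrite /b [X in _ <= _ + X](bigD1 i)//= addrCA lerDl addr_ge0// sumr_ge0// => k _.
  by rewrite sumr_ge0.
have b_gt0 : 0 < b.
  by rewrite ltr_pwDl// sumr_ge0// => k _; rewrite sumr_ge0.
(* This K makes 3 b <= eps K, so that eps |x_i| <= c_i + b K^i = 3 b K^i closes the induction. *)
pose K : R := 1 + 3 * b / eps.
have K1 : 1 <= K by rewrite lerDl divr_ge0 ?mulr_ge0 ?ltW.
have bK : 3 * b <= eps * K.
  have : 3 * b / eps * eps = 3 * b by rewrite divfK ?gt_eqF.
  by rewrite /K; move: (_ / _) => t; have := eps_gt0; lra.
exists (\row_i (2 * b * K ^+ i)) => x xs.
have xB (i : 'I_n) : (forall j : 'I_n, (j < i)%N -> `|x ord0 j| <= K ^+ j.+1) ->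
    `|(x *m B) ord0 i| <= b * K ^+ i.
  move=> xK; rewrite mxE; apply: le_trans (ler_norm_sum _ _ _) _.
  apply: le_trans (ler_wpM2r _ (b_ge i)); last by rewrite exprn_ge0// (le_trans ler01).
  rewrite mulr_suml; apply: ler_sum => j _; rewrite normrM mulrC.
  case: (ltnP j i) => [ji|/B_strict->]; last by rewrite normr0 !mul0r.
  rewrite ler_wpM2l//; apply: le_trans (xK j ji) _; exact: ler_weXn2l.
have xK i : `|x ord0 i| <= K ^+ i.+1.
  have [m im] := ubnP (val i); elim: m i im => // m IH i im.
  have /xB xBi : forall j : 'I_n, (j < i)%N -> `|x ord0 j| <= K ^+ j.+1.
    by move=> j ji; apply: IH; apply: leq_trans ji im.
  rewrite -(ler_pM2l eps_gt0); apply: le_trans (xs i) _.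
  rewrite /slack mxE; apply: le_trans (ler_normB _ _) _.
  have Ki : 0 <= K ^+ i by rewrite exprn_ge0// (le_trans ler01).
  have -> : `|2 * b * K ^+ i| = 2 * b * K ^+ i.
    by rewrite ger0_norm// !mulr_ge0// ltW.
  by have := ler_wpM2r Ki bK; rewrite exprS; lra.
move=> i; have : 0 < b * K ^+ i by rewrite mulr_gt0// exprn_gt0// (lt_le_trans ltr01).
have := xB i (fun j _ => xK j); rewrite ler_norml /slack [X in X - _]mxE -mulrA; lra.
Qed.

End SlackBound.

(** * Perturbation of row-injective matrices and of their kernel vectors *)

Section Perturbation.
Variables (R : realType) (n p : nat) (A D : 'M[R]_(n, p)).
Hypothesis A_inj : forall v : 'rV_n, v *m A = 0 -> v = 0.

Let A_retract : exists A' : 'M_(p, n), A *m A' = 1%:M.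
Proof. exact/row_freeP/inj_row_free. Qed.

(** For a right inverse A' of A, this is (A + e D) A'; [Kp] is the same matrix with e as an
    indeterminate. *)
Let K A' e : 'M[R]_n := 1%:M + e *: (D *m A').
Let Kp (A' : 'M[R]_(p, n)) : 'M[{poly R}]_n :=
  1%:M + 'X *: map_mx polyC (D *m A').

Let KpE A' e : map_mx (horner_eval e) (Kp A') = K A' e.
Proof.
apply/matrixP => i j; rewrite !mxE /horner_eval !hornerE; congr (_ + _).
by case: (i == j); rewrite /= ?mulr1n ?mulr0n ?hornerC.
Qed.

Let det_Kp A' e : (\det (Kp A')).[e] = \det (K A' e).
Proof. by rewrite -KpE det_map_mx. Qed.

Let det_K0 A' : \det (K A' 0) = 1.
Proof. by rewrite /K scale0r addr0 det1. Qed.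

Let mulK A' e : A *m A' = 1%:M -> (A + e *: D) *m A' = K A' e.
Proof. by move=> AA'; rewrite mulmxDl AA' -scalemxAl. Qed.

(** The determinant of (A + e D) A' is a polynomial in e with value 1 at 0. *)
Lemma perturb_inj : small (fun e => forall v : 'rV_n, v *m (A + e *: D) = 0 -> v = 0).
Proof.
have [A' AA'] := A_retract.
have : 0 < (\det (Kp A')).[0] by rewrite det_Kp det_K0.
move=> /small_poly_gt0; apply: small_mono => e _; rewrite det_Kp => Ke v vA.
have Ku : K A' e \in unitmx by rewrite unitmxE unitfE gt_eqF.
have : v *m K A' e = 0 by rewrite -mulK// mulmxA vA mul0mx.
by move=> /(congr1 (mulmx^~ (invmx (K A' e)))); rewrite mulmxK// mul0mx.
Qed.

(* The perturbed kernel vector comes from Cramer's rule, so that its entries are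
   polynomials in [e]. *)
Lemma perturb_kernel (l : 'cV[R]_p) : A *m l = 0 ->
  small (fun e => exists2 m : 'cV[R]_p, (A + e *: D) *m m = 0 &
    forall i, 0 < l i ord0 -> 0 < m i ord0).
Proof.
move=> Al; have [A' AA'] := A_retract.
(* As (A + e D) l = e D l and (A + e D) A' adj(K) = det(K) id, the images of the two terms cancel;
   at e = 0 the vector is l. *)
pose m e := \det (K A' e) *:
  (\det (K A' e) *: l - e *: (A' *m (\adj (K A' e) *m (D *m l)))).
pose mp : 'cV[{poly R}]_p := \det (Kp A') *:
  (\det (Kp A') *: map_mx polyC l -
   'X *: (map_mx polyC A' *m (\adj (Kp A') *m map_mx polyC (D *m l)))).
have polyCK a b (M : 'M[R]_(a, b)) e : map_mx (horner_eval e) (map_mx polyC M) = M.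
  by apply/matrixP => i j; rewrite !mxE /horner_eval hornerC.
have mpE e i : (mp i ord0).[e] = m e i ord0.
  have -> : m e = map_mx (horner_eval e) mp; last by rewrite [in RHS]mxE.
  rewrite /mp map_mxZ map_mxB !map_mxZ !map_mxM /= !polyCK map_mx_adj KpE.
  by rewrite -[horner_eval e _]/((\det (Kp A')).[e]) det_Kp /horner_eval hornerX.
have : small (fun e => forall i, 0 < l i ord0 -> 0 < m e i ord0).
  apply: small_forall => i; have [li|li] := ltP 0 (l i ord0); last by exists 1.
  have : 0 < (mp i ord0).[0].
    by rewrite mpE /m det_K0 !scale1r scale0r subr0.
  by move=> /small_poly_gt0; apply: small_mono => e _; rewrite mpE.
apply: small_mono => e _ me; exists (m e) => //.
rewrite /m -scalemxAr mulmxBr -!scalemxAr [_ *m (A' *m _)]mulmxA mulK//.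
rewrite [K A' e *m _]mulmxA mul_mx_adj mul_scalar_mx mulmxDl Al add0r -scalemxAl.
by rewrite !scalerA mulrC subrr scaler0.
Qed.

End Perturbation.

(** * Newton polynomials and Lagrange weights *)

Section PolynomialNodes.
Variable R : realType.

(* Newton basis for the nodes 1, 2, 3, ... *)
Definition newton (j : nat) : {poly R} := \prod_(k < j) ('X - (k.+1)%:R%:P).

Lemma size_newton j : size (newton j) = j.+1.
Proof. by rewrite size_prod_XsubC /index_enum -enumT size_enum_ord. Qed.

Lemma newton_eq0 j i : (0 < i <= j)%N -> (newton j).[i%:R] = 0.
Proof.
case: i => // i /= ij; rewrite horner_prod (bigD1 (Ordinal ij))//=.
by rewrite !hornerE subrr mul0r.
Qed.

Lemma newton_neq0 j : (newton j).[j.+1%:R] != 0.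
Proof.
rewrite horner_prod; apply/prodf_neq0 => k _.
by rewrite !hornerE subr_eq0 eqr_nat eqSS gtn_eqF.
Qed.

Lemma nodes_poly_eq0 n (A : pred 'I_n) (p : {poly R}) :
  (size p <= #|A|)%N -> (forall i, i \in A -> p.[i%:R] = 0) -> p = 0.
Proof.
move=> pA A0; apply: (@roots_geq_poly_eq0 _ _ [seq (val i)%:R | i <- enum A]).
- by apply/allP => _ /mapP[i /[1!mem_enum] iA ->]; apply/rootP/A0.
- rewrite map_inj_uniq ?enum_uniq// => i j /eqP; rewrite eqr_nat => /eqP.
  exact: val_inj.
- by rewrite size_map -cardE.
Qed.

Variables (n m : nat).
Hypothesis n_gt1 : (1 < n)%N.

Lemma card_nonzero : #|[pred i : 'I_n | val i != 0]| = n.-1.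
Proof.
case: n n_gt1 => // n' _; have := cardC1 (ord0 : 'I_n'.+1).
by rewrite card_ord => <-; apply: eq_card.
Qed.

(** Numerator of the Lagrange basis polynomial for the nodes 1, ..., n - 1; index 0 is not a
    node. *)
Definition node_poly (i : 'I_n) : {poly R} :=
  \prod_(k < n | (k != i) && (val k != 0)) ('X - (val k)%:R%:P).

Lemma node_poly_monic i : node_poly i \is monic.
Proof. exact: monic_prod_XsubC. Qed.

Lemma size_node_poly i : val i != 0 -> size (node_poly i) = n.-1.
Proof.
move=> i0; rewrite /node_poly -big_filter size_prod_XsubC -card_nonzero.
rewrite (cardD1x (j := i))// add1n; congr _.+1.
rewrite -sum1_card -sum1_size big_filter; apply: eq_bigl => k.
by rewrite !inE andbC.
Qed.

Lemma node_poly_eq0 (i j : 'I_n) : val i != 0 -> i != j -> (node_poly j).[i%:R] = 0.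
Proof.
move=> i0 ij; rewrite horner_prod (bigD1 i) ?ij//=.
by rewrite !hornerE subrr mul0r.
Qed.

Lemma node_poly_neq0 i : (node_poly i).[i%:R] != 0.
Proof.
rewrite horner_prod; apply/prodf_neq0 => k /andP[ki _].
by rewrite !hornerE subr_eq0 eqr_nat eq_sym.
Qed.

(* Barycentric Lagrange weights of the nodes 1, ..., n-1. *)
Definition weight (i : 'I_n) : R :=
  if val i == 0 then 0 else (node_poly i).[i%:R]^-1.

Lemma weight_neq0 i : val i != 0 -> weight i != 0.
Proof. by move=> /negPf i0; rewrite /weight i0 invr_eq0 node_poly_neq0. Qed.

(* The sum is the divided difference of p at the nodes. *)
Lemma sum_weight_horner (p : {poly R}) : (size p <= n.-2)%N ->
  \sum_i weight i * p.[(val i)%:R] = 0.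
Proof.
move=> sp; pose h := \sum_i (weight i * p.[(val i)%:R]) *: node_poly i - p.
have h0 : h = 0.
  apply: (@nodes_poly_eq0 n [pred i | val i != 0]).
    rewrite card_nonzero /h; apply: leq_trans (size_polyD _ _) _.
    rewrite geq_max size_polyN (leq_trans sp) ?leq_pred// andbT.
    apply: leq_trans (size_sum _ _ _) _; apply/bigmax_leqP => i _.
    have [i0|i0] := eqVneq (val i) 0%N; last first.
      by apply: leq_trans (size_scale_leq _ _) _; rewrite size_node_poly.
    by rewrite /weight i0 eqxx mul0r scale0r size_poly0.
  move=> i; rewrite inE => i0; rewrite /h !hornerE horner_sum (bigD1 i)//= hornerZ.
  rewrite big1 ?addr0 => [|j ji]; last first.
    by rewrite hornerZ node_poly_eq0 ?mulr0// eq_sym.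
  rewrite /weight (negPf i0) mulrAC mulVf ?mul1r ?subrr//.
  exact: node_poly_neq0.
(* In degree n - 2 each monic [node_poly] at a node contributes its weighted value, and p
   contributes nothing. *)
have := congr1 (fun q : {poly R} => q`_n.-2) h0; rewrite coef0 coefB coef_sum.
rewrite (nth_default 0 sp) subr0 => h1; rewrite -[RHS]h1.
apply: eq_bigr => i _; rewrite coefZ.
have [i0|i0] := eqVneq (val i) 0%N; first by rewrite /weight i0 eqxx !mul0r.
have /monicP := node_poly_monic i; rewrite lead_coefE size_node_poly// => ->.
by rewrite mulr1.
Qed.

(** Since the j-th Newton polynomial vanishes at 1, ..., j and column 0 has weight 0, the matrix is
    strictly triangular. *)
Definition nodemx : 'M[R]_n :=
  \matrix_(j, i) if (j < m)%N then weight i * (newton j).[(val i)%:R] else 0.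

Lemma nodemx_strict (j i : 'I_n) : (i <= j)%N -> nodemx j i = 0.
Proof.
move=> ij; rewrite mxE; case: ifP => // _; have [i0|i0] := eqVneq (val i) 0%N.
  by rewrite /weight i0 eqxx mul0r.
by rewrite newton_eq0 ?mulr0// lt0n i0.
Qed.

Definition newton_comb (v : 'rV[R]_n) : {poly R} :=
  \sum_(j < n | (j < m)%N) v ord0 j *: newton j.

Lemma mul_nodemx v i :
  (v *m nodemx) ord0 i = weight i * (newton_comb v).[(val i)%:R].
Proof.
rewrite mxE horner_sum mulr_sumr [RHS]big_mkcond; apply: eq_bigr => j _.
by rewrite mxE; case: ifP => _; rewrite ?mulr0// hornerZ mulrCA.
Qed.

Lemma size_newton_comb v : (size (newton_comb v) <= m)%N.
Proof.
apply: leq_trans (size_sum _ _ _) _; apply/bigmax_leqP => j jm.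
by apply: leq_trans (size_scale_leq _ _) _; rewrite size_newton.
Qed.

Lemma newton_comb_eq0 v : newton_comb v = 0 ->
  forall j : 'I_n, (j < m)%N -> v ord0 j = 0.
Proof.
move=> v0 j; have [k jk] := ubnP (val j); elim: k j jk => // k IH j jk jm.
have := congr1 (fun q : {poly R} => q.[j.+1%:R]) v0.
rewrite horner0 horner_sum (bigD1 j)//= big1 ?addr0 => [|i /andP[im ij]].
  by rewrite hornerZ => /eqP; rewrite mulf_eq0 (negPf (newton_neq0 j)) orbF => /eqP.
rewrite hornerZ; have [ltij|leji] := ltnP i j.
  by rewrite IH ?mul0r//; apply: leq_trans ltij jk.
by rewrite newton_eq0 ?mulr0//= ltn_neqAle leji andbT eq_sym.
Qed.

(** The first m entries of v are the Newton coefficients of a polynomial of degree below m, which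
    vanishes if it has m distinct roots. *)
Lemma nodemx_inj (A : pred 'I_n) v : (m <= #|A|)%N ->
  (forall i, i \in A -> (newton_comb v).[(val i)%:R] = 0) ->
  (forall j : 'I_n, (m <= j)%N -> v ord0 j = 0) -> v = 0.
Proof.
move=> mA vA vm; apply/rowP => j; rewrite mxE.
have [jm|/vm//] := ltnP j m; apply: newton_comb_eq0 jm.
by apply: nodes_poly_eq0 vA; apply: leq_trans mA; apply: size_newton_comb.
Qed.

End PolynomialNodes.

(** * General position and positive dependencies of the truncated normals *)

Section GeneralPosition.
Variables (R : realType) (n d : nat).
Hypothesis d_le_n : (d <= n)%N.

Definition coordmx : 'M[R]_(n, d) :=
  \matrix_(j, a) ((val j == n - d + val a)%N)%:R.

Let last_ord_subproof (a : 'I_d) : (n - d + a < n)%N.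
Proof. by rewrite -ltn_subRL subKn. Qed.

Definition last_ord a : 'I_n := Ordinal (last_ord_subproof a).

Lemma mul_coordmx (v : 'rV[R]_n) a : (v *m coordmx) ord0 a = v ord0 (last_ord a).
Proof.
rewrite mxE (bigD1 (last_ord a))//= mxE eqxx mulr1 big1 ?addr0// => j ja.
by rewrite mxE -[_ == _]/(j == last_ord a) (negPf ja) mulr0.
Qed.

Lemma mul_coordmx_eq0 (v : 'rV[R]_n) : v *m coordmx = 0 ->
  forall j : 'I_n, (n - d <= j)%N -> v ord0 j = 0.
Proof.
move=> v0 j nj; have jd : (j - (n - d) < d)%N.
  by rewrite ltn_subLR// subnK.
have := mul_coordmx v (Ordinal jd); rewrite v0 mxE => /esym; congr (v _ _ = _).
by apply: val_inj; rewrite /= subnKC.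
Qed.

Lemma coordmx_surj (z : 'rV[R]_d) : exists v : 'rV_n, v *m coordmx = z.
Proof.
exists (\row_j oapp (fun a => z ord0 a) 0 [pick a | last_ord a == j]).
apply/rowP => a; rewrite mul_coordmx mxE; case: pickP => [b|/(_ a)]; last first.
  by rewrite eqxx.
by rewrite -val_eqE eqn_add2l => /eqP/val_inj->.
Qed.

(** Column i is the facet normal selected by [s], or 0 if i is free, written as a perturbation of
    its value at e = 0. *)
Definition signmx (B : 'M[R]_n) (s : 'I_n -> option bool) e : 'M[R]_n :=
  \matrix_(j, i) (if s i then B j i else 0) + e *: diag_mx (\row_i sg R (s i)).

Lemma mul_signmx B s e (v : 'rV[R]_n) i : (v *m signmx B s e) ord0 i =
  if s i then e * (sg R (s i) * v ord0 i) + (v *m B) ord0 i else 0.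
Proof.
rewrite mulmxDr -scalemxAr mul_mx_diag; set M := matrix_of_fun _ _; rewrite !mxE.
case si : (s i) => [b|] /=; last first.
  by rewrite big1 ?mulr0 ?addr0// => j _; rewrite mxE si mulr0.
rewrite addrC [v _ _ * _]mulrC; congr (_ + _); apply: eq_bigr => j _.
by rewrite mxE si.
Qed.

Lemma supp_card (s : 'I_n -> option bool) :
  (#|[pred i | isSome (s i)]| = n - #|free s|)%N.
Proof.
have := cardC (free s); rewrite card_ord => sn; rewrite -[X in (X - _)%N]sn addKn.
by apply: eq_card => i; rewrite !inE negbK.
Qed.

Hypothesis d_gt1 : (1 < d)%N.
Let n_gt1 : (1 < n)%N. Proof. exact: leq_trans d_gt1 d_le_n. Qed.

Notation B := (nodemx R n (n - d)).

(** Once the earlier coordinates vanish, the i-th equation reduces to e v_i = 0 up to sign. *)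
Lemma signmx_upper s e (v : 'rV[R]_n) (k : nat) : 0 < e -> v *m signmx B s e = 0 ->
  (forall i : 'I_n, (i < k)%N -> s i) -> forall i : 'I_n, (i < k)%N -> v ord0 i = 0.
Proof.
move=> e0 vs sk i; have [m im] := ubnP (val i); elim: m i im => // m IH i im ik.
have := mul_signmx B s e v i; rewrite vs mxE sk// [X in _ + X]mxE big1 => [|j _].
  move=> /esym/eqP; rewrite addr0 !mulf_eq0 gt_eqF//=.
  by case: (s i) (sk i ik) => //= b _; rewrite signr_eq0 => /eqP.
have [ji|ij] := ltnP j i; last by rewrite nodemx_strict// mulr0.
by rewrite IH ?mul0r//; [exact: leq_trans ji im|exact: ltn_trans ji ik].
Qed.

(* Once the coordinates before the first free index k have been eliminated, only
   the rows beyond k remain, and at e = 0 the eliminated coordinates make the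
   nodes 1, ..., k roots as well, which compensates for the missing rows. *)
Lemma small_signmx_inj (s : 'I_n -> option bool) : (#|free s| <= d)%N ->
  small (fun e : R => forall v : 'rV[R]_n,
    v *m signmx B s e = 0 -> v *m coordmx = 0 -> v = 0).
Proof.
move=> sd.
(* [A k] replaces the columns before k by unit vectors, which pin the eliminated coordinates to 0;
   [D k] perturbs only the columns after k. *)
pose A (k : 'I_n) : 'M[R]_n :=
  \matrix_(j, i) if (i < k)%N then (j == i)%:R else if s i then B j i else 0.
pose D (k : 'I_n) : 'M[R]_n := diag_mx (\row_i (if (k < i)%N then sg R (s i) else 0)).
have mulA (v : 'rV[R]_n) k i : (v *m A k) ord0 i = 
    if (i < k)%N then v ord0 i else if s i then (v *m B) ord0 i else 0.
  rewrite mxE; case: ifP => ik.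
    rewrite (bigD1 i)//= mxE ik eqxx mulr1 big1 ?addr0// => j /negPf ji.
    by rewrite mxE ik ji mulr0.
  case: ifP => si; last by rewrite big1// => j _; rewrite mxE ik si mulr0.
  by rewrite mxE; apply: eq_bigr => j _; rewrite [A _ _ _]mxE ik si.
have smallA k : small (fun e : R => s k = None -> forall v : 'rV[R]_n,
    v *m row_mx (A k + e *: D k) coordmx = 0 -> v = 0).
  case sk : (s k) => [b|]; first by exists 1.
  have : forall v : 'rV[R]_n, v *m row_mx (A k) coordmx = 0 -> v = 0.
    move=> v; rewrite mul_mx_row => /eqP; rewrite row_mx_eq0 => /andP[/eqP vA /eqP vQ].
    have vA0 i : (v *m A k) ord0 i = 0 by rewrite vA mxE.
    pose Z := [pred i : 'I_n | (val i != 0%N) && (s i || (i <= k)%N)].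
    apply: (@nodemx_inj R n (n - d) Z); last exact: mul_coordmx_eq0.
      (* Counting k along with the fixed indices gives one more, which makes up for the loss of
         index 0. *)
      rewrite -ltnS; apply: leq_trans (_ : #|[pred i | s i || (i == k)]| <= _)%N.
        rewrite (cardD1x (j := k)) ?eqxx ?orbT// add1n ltnS.
        rewrite (@eq_card _ _ [pred i | isSome (s i)]) ?supp_card ?leq_sub2l// => i.
        by rewrite !inE; case: (eqVneq i k) => [->|]; rewrite ?sk ?andbF ?andbT ?orbF.
      pose z : 'I_n := Ordinal (ltnW n_gt1).
      apply: leq_trans (_ : #|[predU1 z & Z]| <= _)%N.
        apply: subset_leq_card; apply/fintype.subsetP => i.
        rewrite !inE -[i == z]/(val i == 0%N).
        by case: (val i == 0%N) => //= /orP[->//|/eqP->]; rewrite leqnn orbT.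
      by rewrite cardU1; case: (_ \notin _).
    move=> i; rewrite inE => /andP[i0 sik].
    have [ki|ik] := ltnP k i.
      have := vA0 i; rewrite mulA ltnNge (ltnW ki)/=; case: ifP => [_|si _].
        rewrite mul_nodemx => /eqP; rewrite mulf_eq0 (negPf (weight_neq0 _ i0)).
        by move=> /eqP.
      by rewrite si leqNgt ki in sik.
    rewrite /newton_comb horner_sum big1// => j _; rewrite hornerZ.
    have [jk|kj] := ltnP j k.
      by have := vA0 j; rewrite mulA jk => ->; rewrite mul0r.
    by rewrite newton_eq0 ?mulr0// lt0n i0 (leq_trans ik).
  move=> inj; apply: small_mono (perturb_inj (row_mx (D k) 0) inj) => e _ He _ v ve.
  by apply: He; rewrite scale_row_mx add_row_mx scaler0 addr0.
apply: small_mono (small_forall smallA) => e e0 He v vs vQ.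
have [sall|] := pselect (forall i, s i).
  by apply/rowP => i; rewrite mxE (@signmx_upper s e v n).
move=> /existsNP[k0 /negP sk0].
have [k sk kmin] := @arg_minnP _ k0 [pred i | ~~ isSome (s i)] val sk0.
have skN : s k = None by move: sk => /=; case: (s k).
have pre (i : 'I_n) : (i < k)%N -> s i.
  by move=> ik; apply: contraT => /kmin; rewrite leqNgt ik.
have vk := signmx_upper e0 vs pre.
apply: (He k skN); rewrite mul_mx_row vQ; apply/eqP; rewrite row_mx_eq0 eqxx andbT.
apply/eqP/rowP => i; rewrite mulmxDr -scalemxAr mul_mx_diag mxE mulA !mxE.
have [ik|ki] := ltnP i k; first by rewrite vk// ltnNge (ltnW ik) /= mul0r mulr0 addr0.
move: ki; rewrite leq_eqVlt => /predU1P[/val_inj <-|ki].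
  by rewrite skN ltnn /= !mulr0 addr0.
have := mul_signmx B s e v i; rewrite vs ki [LHS]mxE [(v *m B) _ _]mxE.
case: (s i) => [b|] h; last by rewrite add0r !mulr0.
by rewrite addrC [v _ _ * _]mulrC; apply: esym h.
Qed.

(* At e = 0 the coefficients are the values of a square polynomial vanishing
   exactly at the free nodes, of low enough degree to be orthogonal to B. *)
Lemma small_positive_dependency r (s : 'I_n -> option bool) :
  (2 * r + 2 <= d)%N -> (#|free s| <= r)%N ->
  small (fun e : R => exists2 l : 'I_n -> R, forall i, s i -> 0 < l i &
    exists u : 'cV[R]_d, forall v : 'rV[R]_n,
      dot v (coordmx *m u) = \sum_i l i * (v *m signmx B s e) ord0 i).
Proof.
move=> rd sr; pose A : 'M[R]_n := \matrix_(j, i) (if s i then B j i else 0).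
pose D : 'M[R]_n := diag_mx (\row_i sg R (s i)).
have inj (v : 'rV[R]_n) : v *m row_mx A coordmx = 0 -> v = 0.
  rewrite mul_mx_row => /eqP; rewrite row_mx_eq0 => /andP[/eqP vA /eqP vQ].
  pose Z := [pred i : 'I_n | (val i != 0%N) && s i].
  apply: (@nodemx_inj R n (n - d) Z); last exact: mul_coordmx_eq0.
    have : (#|[pred i | isSome (s i)]| <= #|Z|.+1)%N.
      pose z : 'I_n := Ordinal (ltnW n_gt1).
      apply: leq_trans (_ : #|[predU1 z & Z]| <= _)%N.
        apply: subset_leq_card; apply/fintype.subsetP => i.
        rewrite !inE -[i == z]/(val i == 0%N).
        by case: (val i == 0%N).
      by rewrite cardU1; case: (_ \notin _).
    move=> suppZ; rewrite -ltnS; apply: leq_trans suppZ.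
    by rewrite supp_card; lia.
  move=> i; rewrite inE => /andP[i0 si].
  have := mul_nodemx (n - d) v i; rewrite mxE => /esym/eqP.
  have -> : \sum_j v ord0 j * B j i = (v *m A) ord0 i.
    by rewrite mxE; apply: eq_bigr => j _; rewrite [A _ _]mxE si.
  by rewrite vA mxE mulf_eq0 (negPf (weight_neq0 _ i0)) => /eqP.
pose p : {poly R} := \prod_(k | k \in free s) (('X - (val k)%:R%:P) ^+ 2).
have p0 i : ~~ s i -> p.[(val i)%:R] = 0.
  move=> si; rewrite /p horner_prod (bigD1 i)//=.
  by rewrite !hornerE subrr expr0n mul0r.
have p_gt0 i : s i -> 0 < p.[(val i)%:R].
  move=> si; rewrite /p horner_prod; apply: prodr_gt0 => k sk.
  rewrite !hornerE exprn_even_gt0//= subr_eq0 eqr_nat.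
  by apply: contraTN si => /eqP/val_inj ->.
have size_p : (size p <= (2 * #|free s|).+1)%N.
  apply: leq_trans (size_prod_leq _ _) _.
  rewrite leq_subLR; apply: leq_trans (_ : (\sum_(k in free s) 3).+1 <= _)%N.
    rewrite ltnS; apply: leq_sum => k _; apply: leq_trans (size_exp_leq _ _) _.
    by rewrite size_XsubC.
  rewrite sum_nat_const [X in (_ <= X + _)%N](@eq_card _ _ (free s))//.
  have card3 f : ((f * 3).+1 <= f + (2 * f).+1)%N by lia.
  exact: card3.
pose l : 'cV[R]_(n + d) := col_mx (\col_i p.[(val i)%:R]) 0.
have Al : row_mx A coordmx *m l = 0.
  rewrite mul_row_col mulmx0 addr0; apply/colP => j; rewrite !mxE.
  have [jd|jd] := ltnP j (n - d); last first.
    by apply: big1 => i _; rewrite !mxE ltnNge jd /=; case: ifP; rewrite mul0r.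
  (* The degree of the product is at most (n - d - 1) + 2 r <= n - 3, within the range of
     [sum_weight_horner]. *)
  have w0 : \sum_(i < n) weight R i * (newton R j * p).[(val i)%:R] = 0.
    apply: sum_weight_horner => //; apply: leq_trans (size_mul_leq _ _) _.
    by rewrite size_newton; lia.
  rewrite -[RHS]w0; apply: eq_bigr => i _; rewrite !mxE jd hornerM.
  by case: ifPn => [_|/p0->]; rewrite ?mulr0// mulrA.
apply: small_mono (perturb_kernel (row_mx D 0) inj Al) => e e0 [m Am ml].
exists (fun i => m (lshift d i) ord0).
  by move=> i si; apply: ml; rewrite col_mxEu mxE p_gt0.
(* The kernel relation says that [signmx B s e *m usubmx m] and [coordmx *m dsubmx m] sum to 0, so
   minus the lower block is the functional on the target space. *)
exists (- dsubmx m) => v; rewrite mulmxN.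
have -> : - (coordmx *m dsubmx m) = signmx B s e *m usubmx m.
  apply/esym/eqP; rewrite -addr_eq0; apply/eqP.
  rewrite -[RHS]Am -[m in RHS]vsubmxK scale_row_mx add_row_mx mul_row_col.
  by rewrite scaler0 addr0.
rewrite /dot mulmxA mxE; apply: eq_bigr => i _.
by rewrite [usubmx _ _ _]mxE mulrC.
Qed.

End GeneralPosition.

(** Fixing free coordinates one by one passes to a subface of any prescribed smaller dimension. *)
Lemma fill_signs n (s : 'I_n -> option bool) k : (k <= #|free s|)%N ->
  exists2 s' : 'I_n -> option bool,
    forall i b, s i = Some b -> s' i = Some b & #|free s'| = k.
Proof.
have [m sm] := ubnP (#|free s| - k)%N; elim: m s sm => // m IH s sm ks.
have [sk|] := eqVneq #|free s| k; first by exists s.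
rewrite eqn_leq ks andbT -ltnNge => lt_ks.
have /card_gt0P[i] : (0 < #|free s|)%N by apply: leq_ltn_trans lt_ks.
rewrite in_free => si.
pose s1 j := if j == i then Some true else s j.
have s1s : (#|free s| = #|free s1|.+1)%N.
  rewrite (cardD1x (j := i))//; rewrite add1n; congr _.+1; apply: eq_card => j.
  by rewrite !inE /s1; case: eqVneq => //=; rewrite ?andbF ?andbT.
have [||s' s's1 s'k] := IH s1; [by lia|by lia|].
exists s' => // j b sj; apply: s's1; rewrite /s1; case: eqVneq => // ji.
by move: si; rewrite -ji sj.
Qed.

(** * Faces and skeleton of the projected cube *)

Section ProjectedCube.
Variables (R : realType) (n d r : nat) (eps : R) (B : 'M[R]_n) (c : 'rV[R]_n).
Variable Q : 'M[R]_(n, d).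
Hypothesis eps_gt0 : 0 < eps.
Hypothesis B_strict : forall j i : 'I_n, (i <= j)%N -> B j i = 0.
Hypothesis slack_gt0 : forall x : 'rV[R]_n,
  (forall i, eps * `|x ord0 i| <= `|slack B c x i|) -> forall i, 0 < slack B c x i.
Hypothesis Q_surj : forall z : 'rV[R]_d, exists v : 'rV_n, v *m Q = z.
Hypothesis Q_inj : forall s, (#|free s| <= d)%N ->
  forall v, direction eps B s v -> v *m Q = 0 -> v = 0.
Hypothesis Q_strict : forall s, (#|free s| <= r)%N ->
  exists2 l : 'I_n -> R, forall i, s i -> 0 < l i &
  exists u : 'cV[R]_d, forall v : 'rV[R]_n, dot v (Q *m u) =
    \sum_i l i * (if s i is Some b then dot v (normal eps B i b) else 0).

Notation C := (dcube eps B c).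
Notation G := (cell C (dfacet eps B c)).
Notation proj := (fun F : set 'rV[R]_n => [set x *m Q | x in F]).

Let C_system := dcube_system eps_gt0 B_strict slack_gt0.

Lemma cell_None : G (fun=> None) = C.
Proof. by apply/seteqP; split=> [x []|]. Qed.

Lemma dcell_has_dim s : has_dim (G s) #|free s|.
Proof.
have := @has_dim_dcell_proj R n eps B c eps_gt0 B_strict slack_gt0 s n 1%:M.
have -> : [set x *m 1%:M | x in G s] = G s.
  by under eq_imagel do rewrite mulmx1; rewrite image_id.
by apply=> v _; rewrite mulmx1.
Qed.

Lemma proj_has_dim s : (#|free s| <= d)%N -> has_dim (proj (G s)) #|free s|.
Proof. by move=> sd; apply: has_dim_dcell_proj => //; apply: Q_inj. Qed.

Lemma proj_dcube_has_dim : has_dim (proj C) d.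
Proof.
have [p] := aff_hull_dcell eps_gt0 B_strict slack_gt0 (fun=> None) Q.
rewrite cell_None => hullE.
apply: (has_dim_param (x := p *m Q) (A := 1%:M)).
  by rewrite row_free_unit unitmx1.
rewrite hullE; apply/seteqP; split=> [_ [v _ <-]|_ [z _ <-]].
  by exists (v *m Q); rewrite ?mulmx1.
by have [v <-] := Q_surj z; exists v; rewrite ?mulmx1.
Qed.

(** The functional u, pulled back along Q, is a positive combination of the normals of the facets
    through the cell. On C it is therefore maximal exactly where all of them are tight. *)
Lemma proj_strict_face s : (#|free s| <= r)%N ->
  face (proj C) (proj (G s)) /\ forall x, C x -> proj (G s) (x *m Q) -> G s x.
Proof.
move=> /Q_strict[l l0 [u uE]].
pose b := \sum_i l i * (if s i then c ord0 i else 0).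
have term_ge0 x i : C x -> 0 <= l i * (if s i then c ord0 i else 0) -
    l i * (if s i is Some b then dot x (normal eps B i b) else 0).
  move=> /(dcubeP B c eps_gt0 _) Cx.
  case si : (s i) => [a|] /=; last by rewrite subrr.
  by rewrite -mulrBr mulr_ge0 ?subr_ge0//; apply/ltW/l0; rewrite si.
have gapE x : b - dot (x *m Q) u = \sum_i (l i * (if s i then c ord0 i else 0) -
    l i * (if s i is Some b then dot x (normal eps B i b) else 0)).
  by rewrite sumrB dot_mulmx uE.
have dot_le x : C x -> dot (x *m Q) u <= b.
  by move=> Cx; rewrite -subr_ge0 gapE sumr_ge0// => i _; apply: term_ge0.
have dot_eq x : C x -> dot (x *m Q) u = b <-> G s x.
  move=> Cx; split=> [xb|[_ xs]].
    split=> // i a si; split=> //.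
    have /eqP := gapE x; rewrite xb subrr eq_sym psumr_eq0;
      last by move=> j _; apply: term_ge0.
    move=> /allP/(_ i); rewrite mem_index_enum si -mulrBr mulf_eq0 gt_eqF ?l0 ?si//= => /(_ isT).
    by rewrite subr_eq0 eq_sym => /eqP.
  apply/esym/subr0_eq; rewrite gapE big1// => i _.
  by case si : (s i) => [a|] /=; rewrite ?subrr// (xs _ _ si).2 subrr.
split.
  exists u, b; split=> [_ [x Cx <-]|]; first exact: dot_le.
  apply/seteqP; split=> [_ [x sx <-]|_ [[x Cx <-] /dot_eq sx]].
    by split; [exists x => //; case: sx|apply/dot_eq => //; case: sx].
  by exists x => //; apply: sx.
by move=> x Cx [y sy yx]; apply/dot_eq => //; rewrite -yx; apply/dot_eq => //; case: sy.
Qed.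

(** The preimage of F in C is a cell on which the pulled-back functional is constant. With more than
    d free coordinates it would contain a subcell whose directions project onto the whole target,
    forcing u = 0. *)
Lemma proj_proper_face F : face (proj C) F -> F <> proj C -> F !=set0 ->
  exists2 s, (#|free s| <= d)%N & F = proj (G s).
Proof.
move=> [u [b [Cb FE]]] FC F0.
have uN0 : u <> 0.
  move=> u0; apply: FC; rewrite FE; apply/seteqP; split=> [z []//|z Cz].
  split=> //=; move: F0; rewrite FE => -[y [_ /= <-]].
  by rewrite u0 !mulmx0.
pose F' := C `&` [set x | dot x (Q *m u) = b].
have projF' : proj F' = F.
  rewrite FE; apply/seteqP; split=> [_ [x [Cx xb] <-]|_ [[x Cx <-] xb]].
    by split; [exists x|rewrite -xb /dot mulmxA].
  by exists x => //; split=> //; rewrite -xb /= /dot mulmxA.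
have FF' : face C F'.
  exists (Q *m u), b; split=> // x Cx.
  by have := Cb (x *m Q); rewrite mulmxA; apply; exists x.
have [s sF'] : exists s, F' = G s.
  apply: (face_cell C_system FF'); move: F0; rewrite -projF' => -[_ [x xF' _]].
  by exists x.
exists s; last by rewrite -projF' sF'.
rewrite leqNgt; apply/negP => /ltnW/fill_signs[s' ss' s'd].
have [A Afree AP] := direction_proj_param eps_gt0 B_strict (Q_inj (eq_leq s'd)).
have /row_fullP[D DAQ] : row_full (A *m Q).
  by move: Afree; rewrite /row_free /row_full => /eqP ->; apply/eqP.
apply/uN0/dot_eq0 => z; rewrite -[z]mulmx1 -DAQ !mulmxA dot_mulmx.
have sb x : G s x -> dot x (Q *m u) = b by rewrite -sF' => -[].
apply: (dcell_normal_vanish eps_gt0 B_strict slack_gt0 sb) => i a /ss' s'i.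
by have /AP : exists w, z *m D *m A = w *m A by [exists (z *m D)]; apply.
Qed.

Lemma proj_dcube_cubical : cubical (proj C).
Proof.
split; first exact/image_polytope/dcube_polytope.
move=> F k FF FC Fk.
have [s sd FE] := proj_proper_face FF FC (has_dim_nonempty Fk).
rewrite FE in Fk *; rewrite (has_dim_inj Fk (proj_has_dim sd)).
by apply: dcell_proj_comb_cube => //; apply: Q_inj.
Qed.

Hypothesis r_lt_d : (r < d)%N.

Lemma skeletonP F : skeleton C r F <->
  F = set0 \/ exists2 s, (#|free s| <= r)%N & F = G s.
Proof.
split=> [[FF [->|[k kr Fk]]]|]; first by left.
  have [s FE] := face_cell C_system FF (has_dim_nonempty Fk).
  right; exists s => //; rewrite FE in Fk.
  by rewrite (has_dim_inj (dcell_has_dim s) Fk).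
case=> [->|[s sr ->]]; first by split; [exact: face_set0|left].
split; first exact: cell_face.
by right; exists #|free s| => //; apply: dcell_has_dim.
Qed.

Lemma proj_skeletonP F : skeleton (proj C) r F <->
  F = set0 \/ exists2 s, (#|free s| <= r)%N & F = proj (G s).
Proof.
split=> [[FF [->|[k kr Fk]]]|]; first by left.
  have [|s sd FE] := proj_proper_face FF _ (has_dim_nonempty Fk).
    (* The whole projection has dimension d > r, so F is a proper face. *)
    move=> FC; move: kr; rewrite FC in Fk.
    by rewrite (has_dim_inj Fk proj_dcube_has_dim) leqNgt r_lt_d.
  right; exists s => //; rewrite FE in Fk.
  by rewrite (has_dim_inj (proj_has_dim sd) Fk).
case=> [->|[s sr ->]]; first by split; [exact: face_set0|left].
split; first exact: (proj_strict_face sr).1.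
by right; exists #|free s| => //; apply/proj_has_dim/(leq_trans sr)/ltnW.
Qed.

(** A point of C that projects into the image of a preserved face lies in that face, so inclusions
    between images reflect inclusions between faces. *)
Lemma proj_skeleton_iso : skeleton_iso_via (fun x => x *m Q) C (proj C) r.
Proof.
have proj0 : proj set0 = set0 by exact: image_set0.
have strict F : skeleton C r F -> forall x, C x -> proj F (x *m Q) -> F x.
  by move=> /skeletonP[->|[s sr ->]] x Cx; [case|exact: (proj_strict_face sr).2].
have sub F : skeleton C r F -> F `<=` C by case=> /face_sub.
have ord F F' : skeleton C r F -> skeleton C r F' ->
    (proj F `<=` proj F' <-> F `<=` F').
  move=> sF sF'; split=> FF' x.
    by move=> Fx; apply: strict sF' _ (sub _ sF _ Fx) (FF' _ _); exists x.
  by move=> [y /FF' F'y <-]; exists y.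
split=> [F sF|].
  split; last first.
    case/skeletonP: sF => [->|[s /proj_strict_face[+ _] ->]] //.
    by rewrite proj0; apply: face_set0.
  split=> [x Fx|x y /set_mem Fx /set_mem Fy|//]; first by exists x.
  case/skeletonP: sF Fx Fy => [->//|[s sr ->] sx sy].
  by apply: (dcell_proj_inj _ sx sy); apply/Q_inj/(leq_trans sr)/ltnW.
split=> //; split.
- move=> F /skeletonP[->|[s sr ->]]; apply/proj_skeletonP; first by left.
  by right; exists s.
- move=> F F' /set_mem sF /set_mem sF' FF'.
  by apply/seteqP; split; apply/ord => //; rewrite FF'.
- move=> F /proj_skeletonP[->|[s sr ->]].
    by exists set0; [apply/skeletonP; left|].
  by exists (G s) => //; apply/skeletonP; right; exists s.
Qed.

End ProjectedCube.

(** * Choice of the parameters and assembly *)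

Lemma mul_signmx_normal (R : realType) n (B : 'M[R]_n) s e (v : 'rV_n) i :
  (v *m signmx B s e) ord0 i =
  if s i is Some b then dot v (normal e B i b) else 0.
Proof.
by rewrite mul_signmx; case: (s i) => // b; rewrite dot_normal mulrCA.
Qed.

Theorem theorem16 (R : realType) (n d r : nat)
    (hnd : (d <= n)%N) (hdr : (2 * r + 2 <= d)%N) :
  exists (C : set 'rV[R]_n) (pi : {linear 'rV[R]_n -> 'rV[R]_d}),
    [/\ comb_cube n C,
        set_surj setT setT pi,
        cubical (pi @` C),
        has_dim (pi @` C) d
      & skeleton_iso_via pi C (pi @` C) r].
Proof.
have d_gt1 : (1 < d)%N by lia.
have r_lt_d : (r < d)%N by lia.
pose B := nodemx R n (n - d); pose Q := coordmx R n d.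
(* Sign vectors are taken as finite functions so that they form a finite type and a single [e] works
   for all of them. *)
have [e e0 He] : exists2 e : R, 0 < e & forall s : {ffun 'I_n -> option bool},
    ((#|free s| <= d)%N -> forall v : 'rV[R]_n,
      v *m signmx B s e = 0 -> v *m Q = 0 -> v = 0) /\
    ((#|free s| <= r)%N -> exists2 l : 'I_n -> R, forall i, s i -> 0 < l i &
      exists u : 'cV[R]_d, forall v : 'rV[R]_n,
      dot v (Q *m u) = \sum_i l i * (v *m signmx B s e) ord0 i).
  apply/small_ex/small_forall => s; apply: small_and.
    have [sd|sd] := leqP #|free s| d; last by exists 1.
    by apply: small_mono (small_signmx_inj R hnd d_gt1 sd) => e _ He _.
  have [sr|sr] := leqP #|free s| r; last by exists 1.
  by apply: small_mono (small_positive_dependency R hnd d_gt1 hdr sr) => e _ He _.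
have B_strict : forall j i : 'I_n, (i <= j)%N -> B j i = 0.
  by move=> j i; apply: nodemx_strict.
have Q_surj : forall z : 'rV[R]_d, exists v : 'rV_n, v *m Q = z.
  exact: coordmx_surj.
have ffunS (s : 'I_n -> option bool) : exists f : {ffun 'I_n -> option bool}, s = f.
  by exists (finfun s); apply/funext => i; rewrite ffunE.
have Q_inj : forall s, (#|free s| <= d)%N ->
    forall v, direction e B s v -> v *m Q = 0 -> v = 0.
  move=> s; have [f ->] := ffunS s => fd v fv; apply: (He f).1 => //.
  apply/rowP => i; rewrite mul_signmx_normal mxE.
  by case fi : (f i) => [b|//]; apply: fv.
have Q_strict : forall s, (#|free s| <= r)%N ->
    exists2 l : 'I_n -> R, forall i, s i -> 0 < l i &
    exists u : 'cV[R]_d, forall v : 'rV[R]_n, dot v (Q *m u) =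
      \sum_i l i * (if s i is Some b then dot v (normal e B i b) else 0).
  move=> s; have [f ->] := ffunS s => /(He f).2[l l0 [u uE]]; exists l => //.
  exists u => v; rewrite uE; apply: eq_bigr => i _.
  by rewrite mul_signmx_normal.
(* The right-hand sides are chosen last, since they depend on [e]. *)
have [c c_gt0] := slack_gt0_exists e0 B_strict.
exists (dcube e B c), (mulmxr Q); split.
- exact: cube_system_comb_cube (dcube_polytope e0 B_strict c_gt0)
    (dcube_system e0 B_strict c_gt0).
- by move=> z _; have [v] := Q_surj z; exists v.
- exact: proj_dcube_cubical.
- exact: proj_dcube_has_dim.
- exact: proj_skeleton_iso.
Qed.
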